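(* Let $R(\cdot)$ be a free Schur contraction, i.e. an analytic function $R(z)\in\mathcal L(\ker\bar\omega,\ker\bar\omega^* )$ with $\|R(z)\|\le 1$ $(z\in\mathbb D)$, and let $Y$ be the contractive intertwining lifting of $X$ associated to $R(\cdot)$. For $d\in\mathcal D_X$ put $d(z)=(I-zA(z))^{-1}d$ $(z\in\mathbb D)$, where $A(z)=\Pi W(z)$ and $W(z)=\bar\omega+R(z)(I-\bar\omega^*\bar\omega)$. Then $Y$ is isometric if and only if the following two properties hold for all $d\in\mathcal D_X$: (1) $\displaystyle\lim_{\rho\nearrow 1}\frac1{2\pi}\int_0^{2\pi}\|D_{R(\rho e^{i\theta})}(I-\bar\omega^*\bar\omega)d(\rho e^{i\theta})\|^2\,d\theta=0$; and (2) the Taylor coefficients $d_n$ $(n=0,1,\dots)$ of $d(\cdot)$, $d(z)=\sum_{n\ge0}z^nd_n$, satisfy $\|d_n\|\to0$ as $n\to\infty$.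
   Context: All Hilbert spaces are complex and separable; $\mathbb D$ is the open unit disc. For a contraction $C$, $D_C=(I-C^*C)^{1/2}$ and $\mathcal D_C$ is the closure of the range of $D_C$. $H^2(\mathcal E)$ is the Hardy space of $\mathcal E$-valued functions on $\mathbb D$. Setting: $T'\in\mathcal L(\mathcal H')$ is a completely nonunitary contraction, $T\in\mathcal L(\mathcal H)$ is an isometry, $X\in\mathcal L(\mathcal H,\mathcal H')$ satisfies $T'X=XT$, $\|X\|\le1$. The minimal isometric lifting of $T'$ is $U'$ on $\mathcal K'=\mathcal H'\oplus H^2(\mathcal D_{T'})$, $U'(h'\oplus f)=T'h'\oplus(D_{T'}h'+zf(z))$; $P'$ is the orthogonal projection of $\mathcal K'$ onto $\mathcal H'$. A contractive intertwining lifting of $X$ is $Y\in\mathcal L(\mathcal H,\mathcal K')$ with $U'Y=YT$, $P'Y=X$, $\|Y\|\le1$. The isometry $\omega:(D_XT\mathcal H)^-\to\{D_{T'}Xh\oplus D_Xh:h\in\mathcal H\}^-\subset\mathcal D_{T'}\oplus\mathcal D_X$ is the continuous extension of $D_XTh\mapsto D_{T'}Xh\oplus D_Xh$. The partial isometry $\bar\omega\in\mathcal L(\mathcal D_X,\mathcal D_{T'}\oplus\mathcal D_X)$ equals $\omega$ on $(D_XT\mathcal H)^-$ and $0$ on $\mathcal D_X\ominus(D_XT\mathcal H)^-$. The operators $\Pi',\Pi$ on $\mathcal D_{T'}\oplus\mathcal D_X$ are $\Pi'(d'\oplus d)=d'\in\mathcal D_{T'}$, $\Pi(d'\oplus d)=d\in\mathcal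 D_X$. Given a free Schur contraction $R(\cdot)$, with $W(z)=\bar\omega+R(z)(I-\bar\omega^*\bar\omega)$ and $A(z)=\Pi W(z)$, put $\Gamma(z)=\Pi'W(z)(I-zA(z))^{-1}$. The associated contractive intertwining lifting is $Yh=Xh\oplus\Gamma(\cdot)D_Xh$ $(h\in\mathcal H)$; it is known that this is a bijection between free Schur contractions and contractive intertwining liftings of $X$. *)

(* Defs.v *)
From HB Require Import structures.
From mathcomp Require Import all_boot all_order all_algebra.
From mathcomp Require Import all_classical all_reals all_analysis.
From mathcomp Require Import complex ring lra.

Set Implicit Arguments.
Unset Strict Implicit.
Unset Printing Implicit Defensive.

Import Order.TTheory GRing.Theory Num.Theory.
Import numFieldNormedType.Exports.
Local Open Scope classical_set_scope.
Local Open Scope ring_scope.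
Local Open Scope complex_scope.

(* Following sesquilinear.v, inner is linear in its first argument. *)
HB.mixin Record isHilbert (R : realType) V & CompleteNormedModule R[i] V := {
  inner : {dot V for Num.conj};
  sqr_norm_inner : forall x : V, `|x| ^+ 2 = inner x x
}.

#[short(type="hilbertType")]
HB.structure Definition Hilbert (R : realType) :=
  {V of isHilbert R V & CompleteNormedModule R[i] V}.



Definition rnorm (R : realType) (V : normedModType R[i]) (x : V) : R :=
  complex.Re `|x|.

Lemma ler_sqrt_sqrD (R : realType) (a b c d : R) :
  0 <= a -> 0 <= b -> 0 <= c -> 0 <= d ->
  Num.sqrt ((a + b) ^+ 2 + (c + d) ^+ 2) <=
  Num.sqrt (a ^+ 2 + c ^+ 2) + Num.sqrt (b ^+ 2 + d ^+ 2).
Proof.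
move=> a0 b0 c0 d0.
set p := Num.sqrt (a ^+ 2 + _); set q := Num.sqrt (b ^+ 2 + _).
have p0 : 0 <= p by exact: sqrtr_ge0.
have q0 : 0 <= q by exact: sqrtr_ge0.
have p2 : p ^+ 2 = a ^+ 2 + c ^+ 2 by rewrite sqr_sqrtr// addr_ge0 ?sqr_ge0.
have q2 : q ^+ 2 = b ^+ 2 + d ^+ 2 by rewrite sqr_sqrtr// addr_ge0 ?sqr_ge0.
rewrite -[leRHS]ger0_norm ?addr_ge0// -sqrtr_sqr ler_wsqrtr//.
suff : a * b + c * d <= p * q by nra.
rewrite -(ler_pXn2r (n := 2)) ?nnegrE ?addr_ge0 ?mulr_ge0// exprMn p2 q2.
by have := sqr_ge0 (a * d - b * c); nra.
Qed.

Section RNorm.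
Context {R : realType}.

Section Norm.
Context {V : normedModType R[i]}.
Implicit Types x y : V.

Lemma norm_rnorm x : `|x| = (rnorm x)%:C.
Proof. by rewrite /rnorm RRe_real// normr_real. Qed.

Lemma rnorm_ge0 x : 0 <= rnorm x.
Proof. by rewrite -lecR -norm_rnorm normr_ge0. Qed.

Lemma ler_rnormD x y : rnorm (x + y) <= rnorm x + rnorm y.
Proof. by rewrite -lecR rmorphD /= -!norm_rnorm ler_normD. Qed.

Lemma rnormZ (a : R[i]) x : rnorm (a *: x) = complex.Re `|a| * rnorm x.
Proof.
apply: (@complexI R); rewrite -norm_rnorm normrZ (norm_rnorm x) rmorphM; congr (_ * _).
Qed.

Lemma rnorm0_eq0 x : rnorm x = 0 -> x = 0.
Proof. by move=> x0; apply/normr0_eq0; rewrite norm_rnorm x0. Qed.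
End Norm.
End RNorm.

Section MkDot.
Context {R : realType} {V : lmodType R[i]} (f : V -> V -> R[i]).
Hypotheses (f_lin : forall y a u v, f (a *: u + v) y = a * f u y + f v y)
  (f_herm : forall x y, f x y = Num.conj (f y x))
  (f_gt0 : forall x, x != 0 -> 0 < f x x).

Definition mk_dot_fun & (forall y a u v, f (a *: u + v) y = a * f u y + f v y)
  & (forall x y, f x y = Num.conj (f y x)) & (forall x, x != 0 -> 0 < f x x) := f.
Local Notation g := (mk_dot_fun f_lin f_herm f_gt0).

Let f_linl y : GRing.linear_for *%R (g ^~ y).
Proof. exact: f_lin. Qed.

Let f_linr y : GRing.linear_for (Num.conj \; *%R) (g y).
Proof.
move=> a u v; rewrite /mk_dot_fun (f_herm y (a *: u + v)) f_lin.
by rewrite rmorphD rmorphM (f_herm y u) (f_herm y v).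
Qed.

HB.instance Definition _ := @bilinear_isBilinear.Build R[i] V V R[i] *%R
  (Num.conj \; *%R) g (f_linl, f_linr).

Let f_hermitian x y : g x y = (-1) ^+ false * Num.conj (g y x).
Proof. by rewrite expr0 mul1r /mk_dot_fun f_herm. Qed.

HB.instance Definition _ := isHermitianSesquilinear.Build R[i] V
  false Num.conj g f_hermitian.

HB.instance Definition _ := isDotProduct.Build R[i] V g f_gt0.

Definition mk_dot : {dot V for Num.conj} := g.
End MkDot.

Record closedSubspace (R : realType) (V : hilbertType R) :=
  ClosedSubspace {
    carrier : set V;
    carrier_closed : closed carrier;
    carrier0 : carrier 0;
    carrierP : forall a u v, carrier u -> carrier v -> carrier (a *: u + v)
  }.

Section Subspace.
Context {R : realType} {V : hilbertType R} (S : closedSubspace V).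

Definition carrier_pred : pred V := fun x => `[< carrier S x >].

Lemma carrier_submod : submod_closed carrier_pred.
Proof.
split; first exact/asboolP/carrier0.
by move=> a u v /asboolP Su /asboolP Sv; exact/asboolP/carrierP.
Qed.

HB.instance Definition _ := GRing.isSubmodClosed.Build R[i] V carrier_pred
  (GRing.submod_closed_semi carrier_submod).

Record subspace_sort := Subspace { sub_val : V; _ : carrier_pred sub_val }.

HB.instance Definition _ := [isSub for sub_val].
HB.instance Definition _ := [Choice of subspace_sort by <:].
HB.instance Definition _ := [SubChoice_isSubLmodule of subspace_sort by <:].

Definition sub_norm (x : subspace_sort) : R[i] := `|sub_val x|.

Lemma ler_sub_normD x y : sub_norm (x + y) <= sub_norm x + sub_norm y.
Proof. exact: ler_normD. Qed.

Lemma sub_normZ a x : sub_norm (a *: x) = `|a| * sub_norm x.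
Proof. exact: normrZ. Qed.

Lemma sub_norm0_eq0 x : sub_norm x = 0 -> x = 0.
Proof. by move=> /normr0_eq0 x0; exact: val_inj. Qed.

HB.instance Definition _ := Lmodule_isNormed.Build R[i] subspace_sort
  ler_sub_normD sub_normZ sub_norm0_eq0.

Lemma sub_cauchy_cvg (F : set_system subspace_sort) :
  ProperFilter F -> cauchy F -> cvg F.
Proof.
move=> FF /cauchyP cF.
have : cauchy (sub_val @ F).
  apply/cauchyP => e /cF[x Fx]; exists (sub_val x).
  by move: Fx; rewrite -!ball_normE.
move=> /cauchy_cvg /cvg_ex[l Fl].
have Sl : carrier_pred l.
  apply/asboolP; apply: (closed_cvg _ _ _ _ Fl).
    exact: carrier_closed.
  by near=> x; exact/asboolP/(valP x).
apply/cvg_ex; exists (Subspace Sl).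
move/cvgrPdist_lt : Fl => Fl; apply/cvgrPdist_lt => e e0.
exact: Fl.
Unshelve. all: by end_near. Qed.

HB.instance Definition _ := Uniform_isComplete.Build subspace_sort sub_cauchy_cvg.

Definition sub_inner (x y : subspace_sort) : R[i] := inner (sub_val x) (sub_val y).

Lemma sub_inner_lin y a u v :
  sub_inner (a *: u + v) y = a * sub_inner u y + sub_inner v y.
Proof. by rewrite /sub_inner linearPl. Qed.

Lemma sub_inner_herm x y : sub_inner x y = Num.conj (sub_inner y x).
Proof. by rewrite /sub_inner hermC expr0 mul1r. Qed.

Lemma sub_inner_gt0 x : x != 0 -> 0 < sub_inner x x.
Proof. by move=> x0; apply: neq0_dnorm_gt0. Qed.

Lemma sub_sqr_norm x : `|x| ^+ 2 = sub_inner x x.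
Proof. exact: sqr_norm_inner. Qed.

HB.instance Definition _ := isHilbert.Build R subspace_sort
  (inner := mk_dot sub_inner_lin sub_inner_herm sub_inner_gt0) sub_sqr_norm.

End Subspace.

Coercion subspace_sort : closedSubspace >-> Sortclass.

Record boundedOp (R : realType) (V W : normedModType R[i]) := BoundedOp {
  bop_fun :> {linear V -> W};
  bop_continuous : continuous bop_fun
}.

Section BoundedOp.
Context {R : realType}.
Implicit Types V W : normedModType R[i].

Definition bop0 V W : boundedOp V W :=
  @BoundedOp R V W \0 (fun x => @cst_continuous V W 0 x).

HB.instance Definition _ V W := gen_eqMixin (boundedOp V W).
HB.instance Definition _ V W := gen_choiceMixin (boundedOp V W).
HB.instance Definition _ V W := isPointed.Build (boundedOp V W) (bop0 V W).

Definition contractive V W (A : boundedOp V W) := forall x, `|A x| <= `|x|.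

Definition isometric V W (A : boundedOp V W) := forall x, `|A x| = `|x|.

End BoundedOp.

Section RangeKernel.
Context {R : realType} {V W : hilbertType R} (A : boundedOp V W).

Lemma closure_normP (U : normedModType R[i]) (B : set U) x :
  closure B x <-> forall e : R[i], 0 < e -> exists2 y, B y & `|x - y| < e.
Proof.
split=> [Bx e e0|Bx N /nbhs_normP[e /= e0 eN]].
  have /Bx[y [By xy]] : nbhs x (ball x e) by exact: nbhsx_ballx.
  by exists y => //; move: xy; rewrite -ball_normE.
by have [y By xy] := Bx e e0; exists y; split=> //; exact: eN.
Qed.

Lemma closure_range0 : closure (range A) 0.
Proof. by apply: subset_closure; exists 0 => //; rewrite linear0. Qed.

Lemma closure_rangeP a u v :
  closure (range A) u -> closure (range A) v -> closure (range A) (a *: u + v).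
Proof.
move=> /closure_normP Au /closure_normP Av; apply/closure_normP => e e0.
have a0 : 0 < `|a| + 1 by rewrite ltr_wpDl.
have [|_ [x _ <-] ux] := Au (e / 2 / (`|a| + 1)); first by rewrite !divr_gt0.
have [|_ [y _ <-] vy] := Av (e / 2); first by rewrite divr_gt0.
exists (A (a *: x + y)); first by exists (a *: x + y).
rewrite linearP opprD addrACA -scalerBr [ltRHS]splitr.
apply: le_lt_trans (ler_normD _ _) _; rewrite ltr_leD ?(ltW vy)//.
rewrite normrZ (@le_lt_trans _ _ ((`|a| + 1) * `|u - A x|))//.
  by rewrite ler_wpM2r// lerDl.
by rewrite mulrC -ltr_pdivlMr.
Qed.

Definition closed_range : closedSubspace W := ClosedSubspace
  (@closed_closure W (range A)) closure_range0 closure_rangeP.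

Lemma range_subproof x : carrier_pred closed_range (A x).
Proof. by apply/asboolP; apply: subset_closure; exists x. Qed.

Definition to_range x : subspace_sort closed_range := Subspace (range_subproof x).

Lemma op_kernel_closed : closed [set x | A x = 0].
Proof.
rewrite (_ : mkset _ = A @^-1` [set 0])//; apply: preimage_closed.
  by move=> x _; exact: bop_continuous.
by apply: accessible_closed_set1; apply: hausdorff_accessible; exact: norm_hausdorff.
Qed.

Lemma op_kernel0 : A 0 = 0. Proof. exact: linear0. Qed.

Lemma op_kernelP a u v : A u = 0 -> A v = 0 -> A (a *: u + v) = 0.
Proof. by move=> u0 v0; rewrite linearP u0 v0 scaler0 addr0. Qed.

Definition op_kernel : closedSubspace V := ClosedSubspace op_kernel_closed op_kernel0 op_kernelP.

End RangeKernel.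

(* Hilbert space direct sum; V * W itself carries the max norm. *)
Definition dsum (V W : Type) : Type := (V * W)%type.

Section DirectSum.
Context {R : realType}.

Section Normed.
Context (V W : normedModType R[i]).

HB.instance Definition _ := GRing.Lmodule.copy (dsum V W) (V * W)%type.

Definition dsum_norm (x : dsum V W) : R[i] :=
  (Num.sqrt (rnorm x.1 ^+ 2 + rnorm x.2 ^+ 2))%:C.

Lemma ler_dsum_normD x y : dsum_norm (x + y) <= dsum_norm x + dsum_norm y.
Proof.
rewrite /dsum_norm -rmorphD lecR.
apply: le_trans (ler_sqrt_sqrD (rnorm_ge0 _) (rnorm_ge0 _) (rnorm_ge0 _) (rnorm_ge0 _)).
by rewrite ler_wsqrtr// lerD// lerXn2r ?nnegrE ?addr_ge0 ?rnorm_ge0 ?ler_rnormD.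
Qed.

Lemma dsum_normZ a x : dsum_norm (a *: x) = `|a| * dsum_norm x.
Proof.
rewrite /dsum_norm !rnormZ !exprMn -mulrDr sqrtrM ?sqr_ge0// sqrtr_sqr rmorphM.
congr (_ * _).
rewrite ger0_norm; first exact/RRe_real/normr_real.
by rewrite -lecR (RRe_real (normr_real a)) normr_ge0.
Qed.

Lemma dsum_norm0_eq0 x : dsum_norm x = 0 -> x = 0.
Proof.
case: x => x y [/eqP]; rewrite sqrtr_eq0 => xy0.
have [/eqP x0 /eqP y0] : rnorm x ^+ 2 == 0 /\ rnorm y ^+ 2 == 0.
  by apply/andP; rewrite -paddr_eq0 ?sqr_ge0// eq_le xy0 addr_ge0 ?sqr_ge0.
congr (_, _); apply: rnorm0_eq0; apply/eqP; first by rewrite -sqrf_eq0 x0.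
by rewrite -sqrf_eq0 y0.
Qed.

HB.instance Definition _ := Lmodule_isNormed.Build R[i] (dsum V W)
  ler_dsum_normD dsum_normZ dsum_norm0_eq0.

Lemma dsum_normE (x : dsum V W) :
  `|x| = (Num.sqrt (rnorm x.1 ^+ 2 + rnorm x.2 ^+ 2))%:C.
Proof. by []. Qed.

Lemma dsum_norm_fst (x : dsum V W) : `|x.1| <= `|x|.
Proof.
rewrite dsum_normE norm_rnorm lecR -[leLHS](ger0_norm (rnorm_ge0 _)) -sqrtr_sqr.
by rewrite ler_wsqrtr// lerDl sqr_ge0.
Qed.

Lemma dsum_norm_snd (x : dsum V W) : `|x.2| <= `|x|.
Proof.
rewrite dsum_normE norm_rnorm lecR -[leLHS](ger0_norm (rnorm_ge0 _)) -sqrtr_sqr.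
by rewrite ler_wsqrtr// lerDr sqr_ge0.
Qed.

Lemma dsum_norm_le (x : dsum V W) : `|x| <= `|x.1| + `|x.2|.
Proof.
rewrite dsum_normE !norm_rnorm -rmorphD lecR.
rewrite -[leRHS]ger0_norm ?addr_ge0 ?rnorm_ge0// -sqrtr_sqr ler_wsqrtr//.
by rewrite sqrrD addrAC lerDl mulrn_wge0// mulr_ge0 ?rnorm_ge0.
Qed.

End Normed.

Section Complete.
Context (V W : completeNormedModType R[i]).

Lemma dsum_cauchy_cvg (F : set_system (dsum V W)) :
  ProperFilter F -> cauchy F -> cvg F.
Proof.
move=> FF /cauchyP cF.
have /cauchy_cvg/cvg_ex[l1] : cauchy (@fst V W @ F).
  apply/cauchyP => e /cF[x Fx]; exists x.1.
  change (F [set y : dsum V W | ball x.1 e y.1]).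
  apply: filterS Fx => y; rewrite /= -!ball_normE /= => xy.
  by apply: le_lt_trans xy; exact: (dsum_norm_fst (x - y)).
have /cauchy_cvg/cvg_ex[l2] : cauchy (@snd V W @ F).
  apply/cauchyP => e /cF[x Fx]; exists x.2.
  change (F [set y : dsum V W | ball x.2 e y.2]).
  apply: filterS Fx => y; rewrite /= -!ball_normE /= => xy.
  by apply: le_lt_trans xy; exact: (dsum_norm_snd (x - y)).
move=> /cvgrPdist_lt F2 /cvgrPdist_lt F1; apply/cvg_ex; exists (l1, l2).
apply/cvgrPdist_lt => e e0.
have e20 : 0 < e / 2 by rewrite divr_gt0.
apply: filterS2 (F1 _ e20) (F2 _ e20) => x l1x l2x.
rewrite (le_lt_trans (dsum_norm_le _))// [ltRHS]splitr.
by rewrite ltr_leD ?(ltW l2x).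
Qed.

HB.instance Definition _ := Uniform_isComplete.Build (dsum V W) dsum_cauchy_cvg.

End Complete.

Section Hilbert.
Context (V W : hilbertType R).

Definition dsum_inner (x y : dsum V W) : R[i] :=
  inner x.1 y.1 + inner x.2 y.2.

Lemma dsum_inner_lin y a u v :
  dsum_inner (a *: u + v) y = a * dsum_inner u y + dsum_inner v y.
Proof. by rewrite /dsum_inner /= !linearPl mulrDr addrACA. Qed.

Lemma dsum_inner_herm x y : dsum_inner x y = Num.conj (dsum_inner y x).
Proof.
by rewrite rmorphD /= /dsum_inner hermC [X in _ + X]hermC !expr0 !mul1r.
Qed.

Lemma dsum_sqr_norm (x : dsum V W) : `|x| ^+ 2 = dsum_inner x x.
Proof.
rewrite dsum_normE -rmorphXn sqr_sqrtr ?addr_ge0 ?sqr_ge0//.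
by rewrite rmorphD /= !rmorphXn /= -!norm_rnorm !sqr_norm_inner.
Qed.

Lemma dsum_inner_gt0 x : x != 0 -> 0 < dsum_inner x x.
Proof. by move=> x0; rewrite -dsum_sqr_norm exprn_gt0// normr_gt0. Qed.

HB.instance Definition _ := isHilbert.Build R (dsum V W)
  (inner := mk_dot dsum_inner_lin dsum_inner_herm dsum_inner_gt0) dsum_sqr_norm.

End Hilbert.
End DirectSum.

(* The Hardy space H^2(E): a function f(z) = \sum_n z^n f_n on the unit disc is
   represented by its square summable sequence of Taylor coefficients, with
   norm (\sum_n `|f_n|^2)^(1/2).  Only the normed space structure is built. *)
Section Hardy.
Context {R : realType} (E : normedModType R[i]).
Implicit Types (a b : nat -> E).

Definition sqr_series a : nat -> R := series (fun n => rnorm (a n) ^+ 2).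

Definition square_summable a := cvgn (sqr_series a).

Lemma sqr_series_ndecr a : nondecreasing_seq (sqr_series a).
Proof. by apply: nondecreasing_series => n _ _; exact: sqr_ge0. Qed.

Lemma sqr_series_le a n : square_summable a -> sqr_series a n <= limn (sqr_series a).
Proof. by move=> sa; apply: nondecreasing_cvgn_le => //; exact: sqr_series_ndecr. Qed.

Lemma sqr_series_ge0 a n : 0 <= sqr_series a n.
Proof. by apply: sumr_ge0 => i _; exact: sqr_ge0. Qed.

Lemma square_summable_bounded a M : (forall n, sqr_series a n <= M) ->
  square_summable a.
Proof.
move=> aM; apply: nondecreasing_is_cvgn; first exact: sqr_series_ndecr.
by exists M => _ [n _ <-].
Qed.

Lemma sqrt_sqr_seriesD a b n : Num.sqrt (sqr_series (a \+ b) n) <=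
  Num.sqrt (sqr_series a n) + Num.sqrt (sqr_series b n).
Proof.
elim: n => [|n IH]; first by rewrite /sqr_series !seriesEnat /= !big_geq// sqrtr0 addr0.
have sS (c : nat -> E) : sqr_series c n.+1 =
    Num.sqrt (sqr_series c n) ^+ 2 + rnorm (c n) ^+ 2.
  by rewrite sqr_sqrtr ?sqr_series_ge0// /sqr_series !seriesEnat /= big_nat_recr.
rewrite !sS.
apply: le_trans (ler_sqrt_sqrD (sqrtr_ge0 _) (sqrtr_ge0 _) (rnorm_ge0 _) (rnorm_ge0 _)).
by rewrite ler_wsqrtr// lerD// lerXn2r ?nnegrE ?addr_ge0 ?rnorm_ge0 ?sqrtr_ge0 ?ler_rnormD.
Qed.

Lemma sqr_seriesD_le a b n : square_summable a -> square_summable b ->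
  sqr_series (a \+ b) n <=
  (Num.sqrt (limn (sqr_series a)) + Num.sqrt (limn (sqr_series b))) ^+ 2.
Proof.
move=> sa sb; rewrite -[leLHS]sqr_sqrtr ?sqr_series_ge0//.
rewrite lerXn2r ?nnegrE ?addr_ge0 ?sqrtr_ge0//.
apply: le_trans (sqrt_sqr_seriesD _ _ _) _.
by rewrite lerD// ler_wsqrtr// sqr_series_le.
Qed.

Lemma sqr_seriesZ (c : R[i]) a :
  sqr_series (c \*: a) = (fun n => complex.Re `|c| ^+ 2 * sqr_series a n).
Proof.
apply/funext => n; rewrite /sqr_series !seriesEnat /= mulr_sumr.
by apply: eq_bigr => i _; rewrite rnormZ exprMn.
Qed.

Definition square_summable_pred : pred (nat -> E) := fun a => `[< square_summable a >].

Lemma square_summable_submod : submod_closed square_summable_pred.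
Proof.
split=> [|c a b /asboolP sa /asboolP sb]; apply/asboolP.
  apply: (@square_summable_bounded _ 0) => n.
  by rewrite /sqr_series seriesEnat /= big1// => i _; rewrite /rnorm normr0 expr0n.
have sca : square_summable (c \*: a).
  by rewrite /square_summable sqr_seriesZ; apply: is_cvgM => //; exact: is_cvg_cst.
apply: square_summable_bounded => n; exact: sqr_seriesD_le.
Qed.

HB.instance Definition _ := GRing.isSubmodClosed.Build R[i] (nat -> E)
  square_summable_pred (GRing.submod_closed_semi square_summable_submod).

Record h2 := H2 { h2_coef : nat -> E; _ : square_summable_pred h2_coef }.

HB.instance Definition _ := [isSub for h2_coef].
HB.instance Definition _ := [Choice of h2 by <:].
HB.instance Definition _ := [SubChoice_isSubLmodule of h2 by <:].

Lemma h2_summable (f : h2) : square_summable (h2_coef f).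
Proof. exact/asboolP/(valP f). Qed.
Arguments h2_summable f : clear implicits.

Definition h2_norm (f : h2) : R[i] := (Num.sqrt (limn (sqr_series (h2_coef f))))%:C.

Lemma ler_h2_normD f g : h2_norm (f + g) <= h2_norm f + h2_norm g.
Proof.
rewrite /h2_norm -rmorphD lecR -[leRHS]ger0_norm ?addr_ge0 ?sqrtr_ge0//.
rewrite -sqrtr_sqr ler_wsqrtr//; apply: (limr_le (h2_summable (f + g))).
by apply: nearW => n; apply: sqr_seriesD_le; exact: h2_summable.
Qed.

Lemma h2_normZ c f : h2_norm (c *: f) = `|c| * h2_norm f.
Proof.
have -> : `|c| = (complex.Re `|c|)%:C by rewrite RRe_real ?normr_real.
have c0 : 0 <= complex.Re `|c| by rewrite -lecR RRe_real ?normr_real ?normr_ge0.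
rewrite /h2_norm -rmorphM; congr (_%:C).
rewrite -[X in X * _](ger0_norm c0) -sqrtr_sqr -sqrtrM ?sqr_ge0//; congr Num.sqrt.
rewrite (_ : sqr_series _ = sqr_series (c \*: h2_coef f))// sqr_seriesZ.
have /cvg_lim -> // : (fun n => complex.Re `|c| ^+ 2 * sqr_series (h2_coef f) n)
    @ \oo --> complex.Re `|c| ^+ 2 * limn (sqr_series (h2_coef f)).
by apply: cvgM; [exact: cvg_cst|exact: h2_summable].
Qed.

Lemma h2_norm0_eq0 f : h2_norm f = 0 -> f = 0.
Proof.
move=> [/eqP]; rewrite sqrtr_eq0 => f0; apply/val_inj/funext => n /=.
apply: rnorm0_eq0; apply/eqP; rewrite -sqrf_eq0 eq_le sqr_ge0 andbT.
apply: le_trans f0; apply: le_trans (sqr_series_le n.+1 (h2_summable f)).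
by rewrite /sqr_series seriesEnat /= big_nat_recr//= lerDr sumr_ge0// => i _; exact: sqr_ge0.
Qed.

HB.instance Definition _ := Lmodule_isNormed.Build R[i] h2
  ler_h2_normD h2_normZ h2_norm0_eq0.

Definition cons_coef (x : E) (a : nat -> E) (n : nat) : E :=
  if n is m.+1 then a m else x.

Lemma cons_subproof x (f : h2) : square_summable_pred (cons_coef x (h2_coef f)).
Proof.
apply/asboolP.
apply: (@square_summable_bounded _ (rnorm x ^+ 2 + limn (sqr_series (h2_coef f)))) => -[|n].
  rewrite /sqr_series seriesEnat /= big_geq// addr_ge0 ?sqr_ge0//.
  by apply: le_trans (sqr_series_le 0 (h2_summable f)); exact: sqr_series_ge0.
rewrite /sqr_series seriesEnat /= big_nat_recl//= lerD2l.
by have := sqr_series_le n (h2_summable f); rewrite /sqr_series seriesEnat.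
Qed.

(* The function x + z f(z). *)
Definition h2_cons x (f : h2) : h2 := H2 (cons_subproof x f).

End Hardy.

Section Operators.
Context {R : realType}.
Implicit Types V W : hilbertType R.

Definition separable_space V := exists2 A : set V, countable A & dense A.

Definition adjoint V W (A : boundedOp V W) : boundedOp W V :=
  get [set B : boundedOp W V | forall x y, inner (A x) y = inner x (B y)].

Definition defect V W (C : boundedOp V W) : boundedOp V V :=
  get [set D : boundedOp V V | (forall x, 0 <= inner (D x) x) /\
                               (forall x, D (D x) = x - adjoint C (C x))].

Definition defect_space V W (C : boundedOp V W) : closedSubspace V :=
  closed_range (defect C).

Definition to_defect V W (C : boundedOp V W) : V -> defect_space C :=
  to_range (defect C).

Definition reducing V (A : boundedOp V V) (M : closedSubspace V) :=
  let orth x := forall m, carrier M m -> inner x m = 0 in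
  (forall x, carrier M x -> carrier M (A x)) /\ (forall x, orth x -> orth (A x)).

Definition unitary_on V (A : boundedOp V V) (M : closedSubspace V) :=
  (forall x, carrier M x -> `|A x| = `|x|) /\ A @` carrier M = carrier M.

Definition completely_nonunitary V (A : boundedOp V V) :=
  forall M : closedSubspace V, reducing A M -> unitary_on A M ->
    carrier M = [set 0].

Definition power_series_on_disc (V : normedModType R[i])
    (f : R[i] -> V) (a : nat -> V) :=
  forall z, `|z| < 1 -> series (fun n => z ^+ n *: a n) @ \oo --> f z.

(* For operator-valued functions the strong, weak and norm convergence of a
   power series on the whole disc are equivalent. *)
Definition analytic V W (F : R[i] -> boundedOp V W) :=
  exists Fn : nat -> boundedOp V W,
    forall x, power_series_on_disc (fun z => F z x) (fun n => Fn n x).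

Definition schur_class V W (F : R[i] -> boundedOp V W) :=
  analytic F /\ forall z, `|z| < 1 -> contractive (F z).

(* For a partial isometry A, I - A^* A is the orthogonal projection onto ker A,
   so the default value of insubd is never used. *)
Definition proj_kernel V W (A : boundedOp V W) (x : V) : op_kernel A :=
  insubd 0 (x - adjoint A (A x)).

Definition circle_mean (f : R[i] -> R) (rho : R) : \bar R :=
  (((2 * pi)^-1)%R%:E *
   \int[lebesgue_measure]_(t in `[0%R, (2 * pi)%R])
     (f (rho%:C * (cos t +i* sin t))%R)%:E)%E.

End Operators.

Section Lifting.
Context {R : realType} {H H' : hilbertType R}.
Variables (T' : boundedOp H' H') (T : boundedOp H H) (X : boundedOp H H').

Definition lifting_space : normedModType R[i] :=
  dsum H' (h2 (defect_space T')).

Definition min_isometric_lifting (k : lifting_space) : lifting_space :=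
  (T' k.1, h2_cons (to_defect T' k.1) k.2).

Definition contractive_intertwining_lifting (Y : boundedOp H lifting_space) :=
  [/\ forall h, min_isometric_lifting (Y h) = Y (T h),
      forall h, (Y h).1 = X h & contractive Y].

Definition omega_space : hilbertType R :=
  dsum (defect_space T') (defect_space X).

(* By continuity, the first condition says that w restricts to omega on
   (D_X T H)^-; the second, that w vanishes on the orthogonal complement. *)
Definition omega_bar : boundedOp (defect_space X) omega_space :=
  get [set w : boundedOp (defect_space X) omega_space |
    (forall h, w (to_defect X (T h)) = (to_defect T' (X h), to_defect X h)) /\
    (forall d, (forall h, inner d (to_defect X (T h)) = 0) -> w d = 0)].

Variable S : R[i] -> boundedOp (op_kernel omega_bar) (op_kernel (adjoint omega_bar)).

Definition schur_W (z : R[i]) (d : defect_space X) : omega_space :=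
  omega_bar d + sub_val (S z (proj_kernel omega_bar d)).

Definition schur_A (z : R[i]) (d : defect_space X) : defect_space X :=
  (schur_W z d).2.

(* (I - z A(z))^{-1}: for |z| < 1 the map I - z A(z) is bijective, and pinv is
   its inverse function. *)
Definition schur_resolvent (z : R[i]) : defect_space X -> defect_space X :=
  pinv setT (fun d => d - z *: schur_A z d).

Definition schur_Gamma (z : R[i]) (d : defect_space X) : defect_space T' :=
  (schur_W z (schur_resolvent z d)).1.

Definition associated_lifting (Y : boundedOp H lifting_space) :=
  forall h, (Y h).1 = X h /\
    power_series_on_disc (schur_Gamma ^~ (to_defect X h)) (h2_coef (Y h).2).

End Lifting.

Arguments contractive_intertwining_lifting {R H H'} T' T X Y.

(* Main.v *)
(* Write d(z) = \sum_n z^n d_n and W(z) d(z) = \sum_n z^n (gamma_n, d_(n+1)),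
   so that gamma_n are the coefficients of Gamma(z) d.  Since W(z) is the
   orthogonal sum of a partial isometry and of R(z) on its kernel,
     |W(z) d(z)|^2 = |d(z)|^2 - |D_R(z) (I - w^* w) d(z)|^2,
   and averaging over |z| = rho with Parseval's identity gives
     |d|^2 = \sum_n rho^(2n) |gamma_n|^2 + mean(rho)
             + (1 - rho^2) \sum_n rho^(2n) |d_(n+1)|^2.
   As Y is isometric iff \sum_n |gamma_n|^2 = |d|^2 for all d, letting rho tend
   to 1 yields the "if" part, the last term being an Abel mean of |d_n|^2.
   Conversely, the lower triangular Toeplitz operator with symbol W is
   contractive, which gives
     \sum_(k < n) |gamma_k|^2 + |d_n|^2 <= |d|^2,
   so that d_n tends to 0 when \sum_n |gamma_n|^2 = |d|^2. *)
From HB Require Import structures.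
Require Import Defs.
From mathcomp Require Import all_boot all_order all_algebra.
From mathcomp Require Import all_classical all_reals all_analysis.
From mathcomp Require Import complex.
From mathcomp Require Import measurable_realfun ring lra.
Import Order.TTheory GRing.Theory Num.Theory.
Import numFieldNormedType.Exports.
Set Implicit Arguments.
Unset Strict Implicit.
Unset Printing Implicit Defensive.
Local Open Scope classical_set_scope.
Local Open Scope ring_scope.
Local Open Scope complex_scope.

(** * Real inner products, adjoints and square roots *)

(** [adjoint], [defect] and [omega_bar] are picked by [get], so they carry no information until an
    operator with the required property is exhibited. Hence the operator theory is built from the
    norm upwards: minimising a quadratic functional yields both adjoints and orthogonal projections,
    and a dominated iteration yields square roots. On the function side, d(z) is a value of [pinv],
    about which nothing is known before I - zA(z) is inverted. The order is therefore reversed: the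
    d_n are defined by recursion, the Toeplitz inequality for polynomials bounds them by |d|, and
    only then is their series summed and recognised as the inverse. When Y is isometric, the
    equality of sum |gamma_n|^2 and |d|^2 is immediate only for d in the range of D_X; linearity and
    contractivity of d |-> Gamma d carry it to the closure. Property (1) then follows from the mean
    identity by dropping its nonnegative last term and truncating the sum of the |gamma_n|^2 before
    rho tends to 1. *)

Lemma cvg_dist_le (R : realType) (a b : nat -> R) (l : R) :
  (forall n, `|a n - l| <= b n) -> b @ \oo --> (0 : R) -> a @ \oo --> l.
Proof.
move=> ab b0; apply/subr_cvg0.
apply: (@squeeze_cvgr _ _ _ _ (fun n => - b n) b) => //.
  by apply: nearW => n; rewrite -ler_norml; exact: ab.
by rewrite -oppr0; exact: cvgN.
Qed.

Lemma gtr0C (R : realType) (e : R) : (0 < e%:C :> R[i]) = (0 < e).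
Proof. exact: (ltcR 0 e). Qed.

Section RealNorm.
Context {R : realType} {V : normedModType R[i]}.
Implicit Types (x y : V) (u : nat -> V).

Lemma rnorm0 : rnorm (0 : V) = 0.
Proof. by rewrite /rnorm normr0. Qed.

Lemma rnormN x : rnorm (- x) = rnorm x.
Proof. by rewrite /rnorm normrN. Qed.

Lemma rnormC x y : rnorm (x - y) = rnorm (y - x).
Proof. by rewrite -rnormN opprB. Qed.

Lemma ler_rnormB x y : rnorm (x - y) <= rnorm x + rnorm y.
Proof. by rewrite -(rnormN y); exact: ler_rnormD. Qed.

Lemma rnorm_triangle z x y : rnorm (x - y) <= rnorm (x - z) + rnorm (z - y).
Proof. by rewrite -(subrKA z x (- y)) ; exact: ler_rnormD. Qed.

Lemma rnormZr (a : R) x : rnorm (a%:C *: x) = `|a| * rnorm x.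
Proof. by rewrite rnormZ normc_def /= expr0n addr0 sqrtr_sqr. Qed.

Lemma le_rnorm (W : normedModType R[i]) (y : W) x :
  (`|x| <= `|y|) = (rnorm x <= rnorm y).
Proof. by rewrite !norm_rnorm lecR. Qed.

Lemma ler_rnorm_sum (I : Type) (r : seq I) (P : pred I) (F : I -> V) :
  rnorm (\sum_(i <- r | P i) F i) <= \sum_(i <- r | P i) rnorm (F i).
Proof.
elim/big_ind2: _ => [|x a y b xa yb|//]; first by rewrite rnorm0.
exact: le_trans (ler_rnormD _ _) (lerD xa yb).
Qed.

(** Norms take values in [R[i]], so the radii in a limit are complex; a positive one is real, which
    lets limits be tested by the real number [rnorm]. *)
Lemma cvg_rnormP u (l : V) :
  u @ \oo --> l <-> (fun n => rnorm (u n - l)) @ \oo --> (0 : R).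
Proof.
split=> [/cvgrPdist_lt ul|/cvgrPdist_lt ul]; apply/cvgrPdist_lt => e e0.
  have := ul e%:C; rewrite gtr0C => /(_ e0); apply: filterS => n.
  by rewrite sub0r normrN norm_rnorm ltcR rnormC ger0_norm// rnorm_ge0.
have eE : e = (complex.Re e)%:C by rewrite RRe_real// ger0_real// ltW.
have e0' : 0 < complex.Re e by rewrite -gtr0C -eE.
have := ul _ e0'; apply: filterS => n.
by rewrite sub0r normrN ger0_norm ?rnorm_ge0// norm_rnorm rnormC {2}eE ltcR.
Qed.

Lemma cvg_rnorm u (l : V) :
  u @ \oo --> l -> (fun n => rnorm (u n)) @ \oo --> rnorm l.
Proof.
move=> /cvg_rnormP/cvgrPdist_lt ul; apply/cvgrPdist_lt => e /ul.
apply: filterS => n; rewrite sub0r normrN ger0_norm ?rnorm_ge0// => h.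
apply: le_lt_trans h; rewrite ler_norml; apply/andP; split.
  by have := ler_rnormD (u n - l) l; rewrite subrK; lra.
by have := ler_rnormD (l - u n) (u n); rewrite subrK rnormC; lra.
Qed.

Lemma cvg_rnorm_le u (l : V) (b : nat -> R) :
  (forall n, rnorm (u n - l) <= b n) -> b @ \oo --> (0 : R) -> u @ \oo --> l.
Proof.
move=> ub b0; apply/cvg_rnormP; apply: (cvg_dist_le _ b0) => n.
by rewrite subr0 ger0_norm ?rnorm_ge0.
Qed.

End RealNorm.

Lemma cauchy_rnorm_cvg (R : realType) (V : completeNormedModType R[i])
    (u : nat -> V) (b : nat -> R) :
  (forall m n, (n <= m)%N -> rnorm (u m - u n) <= b n) ->
  b @ \oo --> (0 : R) -> cvgn u.
Proof.
move=> ub /cvgrPdist_lt b0; apply: cauchy_cvg; apply/cauchyP => e e0.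
have eE : e = (complex.Re e)%:C by rewrite RRe_real// ger0_real// ltW.
have e0' : 0 < complex.Re e by rewrite -gtr0C -eE.
have [N _ bN] := b0 _ e0'.
exists (u N), N => // n /= Nn; rewrite -ball_normE /= norm_rnorm eE ltcR rnormC.
apply: le_lt_trans (ub _ _ Nn) _.
by have := bN N (leqnn N); rewrite sub0r normrN; apply: le_lt_trans; exact: ler_norm.
Qed.

Section BoundedOps.
Context {R : realType}.
Implicit Types V W : normedModType R[i].

Lemma bop_bound V W (A : boundedOp V W) :
  exists2 M : R, 0 <= M & forall x, rnorm (A x) <= M * rnorm x.
Proof.
have /linear_boundedP/pinfty_ex_gt0[M M0 AM] :=
  continuous_linear_bounded 0 (@bop_continuous _ _ _ A 0).
have ME : M = (complex.Re M)%:C by rewrite RRe_real// gtr0_real.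
exists (complex.Re M); first by rewrite -lecR -ME ltW.
by move=> x; have := AM x; rewrite !norm_rnorm ME -rmorphM lecR.
Qed.

Lemma mk_bop V W (f : V -> W) (M : R) :
  (forall (a : R[i]) x y, f (a *: x + y) = a *: f x + f y) ->
  (forall x, rnorm (f x) <= M * rnorm x) ->
  exists A : boundedOp V W, forall x, A x = f x.
Proof.
move=> flin fM.
pose fL := GRing.isLinear.Build R[i] V W *:%R f flin.
pose g : {linear V -> W} := HB.pack f fL.
have gc : continuous g.
  apply: bounded_linear_continuous; apply/linear_boundedP.
  near=> r => x; apply: (@le_trans _ _ (M%:C * `|x|)).
    by rewrite !norm_rnorm -rmorphM lecR fM.
  by rewrite ler_wpM2r//; near: r; apply: nbhs_pinfty_ge; rewrite complex_real eqxx.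
by exists (BoundedOp gc).
Unshelve. all: by end_near. Qed.

End BoundedOps.

(** The underlying real inner product keeps estimates in the ordered field [R]; [inner_rin] recovers
    the complex product by testing at ['i *: x] as well. *)
Definition rin (R : realType) (V : hilbertType R) (x y : V) : R :=
  complex.Re (inner x y).

Section RealInner.
Context {R : realType} {V : hilbertType R}.
Implicit Types (x y z : V) (a : R) (c : R[i]).

Lemma innerC x y : inner x y = Num.conj (inner y x).
Proof. by rewrite hermC expr0 mul1r. Qed.

Lemma rinC x y : rin x y = rin y x.
Proof. by rewrite /rin innerC; case: (inner y x). Qed.

Lemma rinDl x y z : rin (x + y) z = rin x z + rin y z.
Proof. by rewrite /rin linearDl raddfD. Qed.

Lemma rinNl x y : rin (- x) y = - rin x y.
Proof. by rewrite /rin linearNl raddfN. Qed.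

Lemma rinBl x y z : rin (x - y) z = rin x z - rin y z.
Proof. by rewrite rinDl rinNl. Qed.

Lemma rinDr x y z : rin z (x + y) = rin z x + rin z y.
Proof. by rewrite rinC rinDl !(rinC z). Qed.

Lemma rinNr x y : rin x (- y) = - rin x y.
Proof. by rewrite rinC rinNl rinC. Qed.

Lemma rinBr x y z : rin z (x - y) = rin z x - rin z y.
Proof. by rewrite rinDr rinNr. Qed.

Lemma inner_Zl c x y : inner (c *: x) y = c * inner x y.
Proof. exact: linearZl_LR. Qed.

Lemma rinZl a x y : rin (a%:C *: x) y = a * rin x y.
Proof. by rewrite /rin inner_Zl; case: (inner x y) => u v /=; rewrite mul0r subr0. Qed.

Lemma rinZr a x y : rin x (a%:C *: y) = a * rin x y.
Proof. by rewrite rinC rinZl rinC. Qed.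

Lemma rin0l x : rin 0 x = 0.
Proof. by rewrite -(subrr 0) rinBl subrr. Qed.

Lemma rin0r x : rin x 0 = 0.
Proof. by rewrite rinC rin0l. Qed.

Lemma rinxx x : rin x x = rnorm x ^+ 2.
Proof. by rewrite /rin -sqr_norm_inner norm_rnorm -rmorphXn. Qed.

Lemma inner_rin x y : inner x y = rin x y +i* (- rin ('i *: x) y).
Proof.
rewrite /rin inner_Zl; case: (inner x y) => u v.
by simpc.
Qed.

Lemma rnormD_sqr x y :
  rnorm (x + y) ^+ 2 = rnorm x ^+ 2 + 2 * rin x y + rnorm y ^+ 2.
Proof. by rewrite -!rinxx !rinDl !rinDr (rinC y x); ring. Qed.

Lemma rnormB_sqr x y :
  rnorm (x - y) ^+ 2 = rnorm x ^+ 2 - 2 * rin x y + rnorm y ^+ 2.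
Proof. by rewrite -!rinxx !rinBl !rinBr (rinC y x); ring. Qed.

Lemma rin_le x y : rin x y <= rnorm x * rnorm y.
Proof.
have [x0|x0] := eqVneq (rnorm x) 0.
  by rewrite (rnorm0_eq0 x0) rin0l mulr_ge0 ?rnorm_ge0.
have [y0|y0] := eqVneq (rnorm y) 0.
  by rewrite (rnorm0_eq0 y0) rin0r mulr_ge0 ?rnorm_ge0.
have xy : 0 < rnorm x * rnorm y by rewrite mulr_gt0 // lt_def ?x0 ?y0 rnorm_ge0.
(* This square expands to 2|x||y|(|x||y| - rin x y). *)
have := sqr_ge0 (rnorm ((rnorm y)%:C *: x - (rnorm x)%:C *: y)).
rewrite rnormB_sqr rinZl rinZr !rnormZr !(ger0_norm (rnorm_ge0 _)) => h.
rewrite -subr_ge0 -(pmulr_rge0 _ xy); nra.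
Qed.

Lemma normr_rin_le x y : `|rin x y| <= rnorm x * rnorm y.
Proof. by rewrite ler_norml lerNl -rinNl -(rnormN x) rin_le rnormN rin_le. Qed.

Lemma rin_ext x y : (forall z, rin x z = rin y z) -> x = y.
Proof.
move=> xy; apply/eqP; rewrite -subr_eq0; apply/eqP/rnorm0_eq0/eqP.
by rewrite -sqrf_eq0 -rinxx rinBl xy subrr.
Qed.

Lemma cvg_rinl (u : nat -> V) x y :
  u @ \oo --> x -> rin (u n) y @[n --> \oo] --> rin x y.
Proof.
move=> /cvg_rnormP ux; apply: (@cvg_dist_le _ _ (fun n => rnorm (u n - x) * rnorm y)).
  by move=> n; rewrite -rinBl; exact: normr_rin_le.
by rewrite -[X in _ --> X](mul0r (rnorm y)); apply: cvgM => //; exact: cvg_cst.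
Qed.

End RealInner.

(** First-order optimality: near t = 0 a nonzero linear term would outweigh the quadratic one. *)
Lemma square_min_eq (R : realFieldType) (p q : R) :
  0 <= q -> (forall t, 0 <= t * p + t ^+ 2 * q) -> p = 0.
Proof.
move=> q0 H; have q1 : 0 < q + 1 by lra.
(* The denominator has q + 1 instead of q so that q = 0 is allowed. *)
have := H (- (p / (2 * (q + 1)))).
set s := p / _; have -> : p = s * (2 * (q + 1)) by rewrite divfK// mulf_neq0 ?gt_eqF.
move=> Hs; have : s ^+ 2 * (q + 2) <= 0 by nra.
have : 0 <= s ^+ 2 by rewrite sqr_ge0.
have [->|s0] := eqVneq s 0; first by rewrite mul0r.
have : 0 < s ^+ 2 by rewrite exprn_even_gt0.
nra.
Qed.

(** * Riesz representation by minimising a quadratic functional *)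

Section RealRiesz.
Context {R : realType} {V : hilbertType R}.
Variables (M : set V) (phi : V -> R) (C : R).
Hypotheses (M_closed : closed M) (M0 : M 0)
  (MD : forall x y, M x -> M y -> M (x + y))
  (MZ : forall (a : R) x, M x -> M (a%:C *: x))
  (phiD : forall x y, phi (x + y) = phi x + phi y)
  (phiZ : forall (a : R) x, phi (a%:C *: x) = a * phi x)
  (phi_bound : forall x, `|phi x| <= C * rnorm x).

Let J x := rnorm x ^+ 2 - 2 * phi x.

Let J_ge x : - (C ^+ 2) <= J x.
Proof.
have := phi_bound x; rewrite ler_norml => /andP[_ h].
have := sqr_ge0 (rnorm x - C); rewrite /J; nra.
Qed.

Let JM := J @` M.

Let JM_inf : has_inf JM.
Proof.
split; first by exists (J 0), 0.
by exists (- (C ^+ 2)) => _ [x _ <-]; exact: J_ge.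
Qed.

Let phiN x : phi (- x) = - phi x.
Proof. by rewrite -scaleN1r -(rmorphN1 (real_complex R)) phiZ mulN1r. Qed.

(** Parallelogram law: the linear parts cancel in 2 J x + 2 J y - 4 J((x + y)/2) = |x - y|^2, and
    the midpoint stays in [M]. *)
Let J_parallelogram x y : M x -> M y ->
  rnorm (x - y) ^+ 2 <= 2 * (J x - inf JM) + 2 * (J y - inf JM).
Proof.
move=> Mx My.
have Mz : M ((2^-1)%:C *: (x + y)) by apply/MZ/MD.
have : inf JM <= J ((2^-1)%:C *: (x + y)).
  by apply: ge_inf; [exact: JM_inf.2|exists ((2^-1)%:C *: (x + y))].
rewrite /J phiZ phiD rnormZr exprMn rnormB_sqr rnormD_sqr.
rewrite (_ : `|2^-1| ^+ 2 = 4^-1 :> R); first lra.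
by rewrite ger0_norm ?invr_ge0// exprVn -natrX.
Qed.

(** Taking the whole space for [M] gives adjoints, taking [rin x] for [phi] gives the projection of
    x on [M]. A minimising sequence of [J] is Cauchy, and the first variation of [J] vanishes at its
    limit. *)
Lemma real_riesz : exists2 m, M m & forall s, M s -> rin m s = phi s.
Proof.
have /choice[u Hu] n : exists x, M x /\ J x < inf JM + n.+1%:R^-1.
  have [|_ [x Mx <-] h] := @inf_adherent _ JM n.+1%:R^-1 _ JM_inf; first by rewrite invr_gt0.
  by exists x.
have Ju n : J (u n) - inf JM < n.+1%:R^-1 by rewrite ltrBlDl (Hu n).2.
have nV m n : (n <= m)%N -> m.+1%:R^-1 <= n.+1%:R^-1 :> R.
  by move=> nm; rewrite lef_pV2 ?posrE// ler_nat ltnS.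
have /cvg_ex[m um] : cvgn u.
  apply: (@cauchy_rnorm_cvg _ _ _ (fun n => Num.sqrt (4 * n.+1%:R^-1))) => [m n nm|].
    rewrite -[leLHS]ger0_norm ?rnorm_ge0// -sqrtr_sqr ler_wsqrtr//.
    apply: le_trans (J_parallelogram (Hu m).1 (Hu n).1) _.
    have := Ju m; have := Ju n; have := nV m n nm.
    move: (m.+1%:R^-1) (n.+1%:R^-1) => p q; lra.
  rewrite -[X in _ --> X]sqrtr0; apply: continuous_cvg; first exact: sqrt_continuous.
  by rewrite -[X in _ --> X](mulr0 4); apply: cvgM; [exact: cvg_cst|exact: cvg_harmonic].
have Mm : M m.
  by apply: (closed_cvg _ M_closed _ _ um); apply: nearW => n; exact: (Hu n).1.
have Jm : J m <= inf JM.
  have phim : phi (u n) @[n --> \oo] --> phi m.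
    apply: (@cvg_dist_le _ _ (fun n => C * rnorm (u n - m))).
      by move=> n; rewrite -phiN -phiD; exact: phi_bound.
    by rewrite -(mulr0 C); apply: cvgM; [exact: cvg_cst|exact/cvg_rnormP].
  apply: (@ler_cvg_to _ _ _ _ (fun n => J (u n)) (fun n => inf JM + n.+1%:R^-1)).
  - exact: eventually_filter.
  - have h1 : rnorm (u n) ^+ 2 @[n --> \oo] --> rnorm m ^+ 2.
      rewrite (_ : (fun n => _) = (fun n => rnorm (u n) * rnorm (u n))).
        by rewrite expr2; apply: cvgM; exact: cvg_rnorm.
      by apply/funext => n; rewrite expr2.
    have h2 : 2 * phi (u n) @[n --> \oo] --> 2 * phi m.
      by apply: cvgM => //; exact: cvg_cst.
    exact: (cvgB h1 h2).
  - rewrite -[X in _ --> X]addr0; apply: cvgD; [exact: cvg_cst|exact: cvg_harmonic].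
  - by apply: nearW => n; exact/ltW/(Hu n).2.
(* Minimality along the line m + t s says 2 t (rin m s - phi s) + t^2 |s|^2 >= 0 for all real t. *)
exists m => // s Ms; apply/eqP; rewrite -subr_eq0; apply/eqP.
suff : 2 * (rin m s - phi s) = 0 by lra.
apply: (@square_min_eq _ _ (rnorm s ^+ 2)); first exact: sqr_ge0.
move=> t.
have : inf JM <= J (m + t%:C *: s).
  by apply: ge_inf; [exact: JM_inf.2|exists (m + t%:C *: s) => //; apply/MD/MZ].
move=> /(le_trans Jm); rewrite /J phiD phiZ rnormD_sqr rinZr rnormZr exprMn.
rewrite -(real_normK (num_real t)); lra.
Qed.

End RealRiesz.

Section Adjoint.
Context {R : realType}.
Implicit Types V W : hilbertType R.

Lemma rin_i V (x y : V) : rin ('i *: x) y = - rin x ('i *: y).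
Proof.
rewrite (rinC x) /rin !inner_Zl (innerC x y); case: (inner y x) => u v.
by simpc.
Qed.

Lemma inner_rinP V W (x y : V) (z w : W) :
  rin x y = rin z w -> rin ('i *: x) y = rin ('i *: z) w -> inner x y = inner z w.
Proof. by move=> h1 h2; rewrite !inner_rin h1 h2. Qed.

Lemma inner_ext V (x y : V) : (forall z, inner z x = inner z y) -> x = y.
Proof. by move=> xy; apply: rin_ext => z; rewrite !(rinC _ z) /rin xy. Qed.

Lemma inner_Zr V (c : R[i]) (x y : V) : inner x (c *: y) = Num.conj c * inner x y.
Proof. by rewrite innerC inner_Zl rmorphM [in RHS]innerC. Qed.

Lemma innerDl V (x y z : V) : inner (x + y) z = inner x z + inner y z.
Proof. exact: linearDl. Qed.

Lemma innerDr V (x y z : V) : inner x (y + z) = inner x y + inner x z.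
Proof. exact: linearDr. Qed.

(** Riesz is applied over the reals to s |-> rin (A s) y; replacing x by ['i *: x] upgrades the
    identity to [inner], and nondegeneracy makes y |-> B y linear. *)
Lemma adjointP V W (A : boundedOp V W) x y : inner (A x) y = inner x (adjoint A y).
Proof.
move: x y; rewrite /adjoint.
suff [B HB] : exists B : boundedOp W V, forall x y, inner (A x) y = inner x (B y).
  by apply: (@getPex _ [set B : boundedOp W V | forall x y, inner (A x) y = inner x (B y)]);
    exists B.
have [M M0 AM] := bop_bound A.
have /choice[B HB] y : exists m, forall s, rin (A s) y = rin s m.
  have [|||||||m _ Hm] := @real_riesz R V setT (fun s => rin (A s) y) (M * rnorm y) => //.
  - by move=> u v; rewrite linearD rinDl.
  - by move=> a u; rewrite linearZ rinZl.
  - move=> u; apply: le_trans (normr_rin_le _ _) _.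
    by rewrite mulrAC ler_wpM2r ?rnorm_ge0.
  by exists m => s; rewrite (rinC s) Hm.
have BE x y : inner (A x) y = inner x (B y).
  by apply: inner_rinP => //; rewrite -linearZ.
have [||B' B'E] := @mk_bop R W V B M.
- move=> a x y; apply: inner_ext => z.
  by rewrite -BE !innerDr !inner_Zr !BE.
- move=> y.
  have [->|By0] := eqVneq (rnorm (B y)) 0; first by rewrite mulr_ge0 ?rnorm_ge0.
  have By : 0 < rnorm (B y) by rewrite lt_def By0 rnorm_ge0.
  rewrite -(ler_pM2l By) -expr2 -rinxx -HB; apply: le_trans (rin_le _ _) _.
  by rewrite mulrA (mulrC (rnorm _) M) ler_wpM2r ?rnorm_ge0.
- by exists B' => x y; rewrite B'E.
Qed.

Lemma rin_adjoint V W (A : boundedOp V W) x y : rin (A x) y = rin x (adjoint A y).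
Proof. by rewrite /rin adjointP. Qed.

(** [p] represents [rin x] on [S], so x - p is orthogonal to [S] for [rin]; since [S] is stable
    under multiplication by i, it is so for [inner] too. *)
Lemma orthogonal_decomposition V (S : closedSubspace V) (x : V) :
  exists2 p, carrier S p & forall s, carrier S s -> inner (x - p) s = 0.
Proof.
have Z a s : carrier S s -> carrier S (a *: s).
  by move=> Ss; have := carrierP a Ss (carrier0 S); rewrite addr0.
have [|||||||p Sp Hp] := @real_riesz R V (carrier S) (rin x) (rnorm x).
- exact: carrier_closed.
- exact: carrier0.
- by move=> u v Su Sv; have := carrierP 1 Su Sv; rewrite scale1r.
- by move=> a u; exact: Z.
- by move=> u v; rewrite rinDr.
- by move=> a u; rewrite rinZr.
- by move=> u; exact: normr_rin_le.
exists p => // s Ss.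
have H t : carrier S t -> rin (x - p) t = 0 by move=> St; rewrite rinBl Hp// subrr.
by rewrite inner_rin rin_i (H _ Ss) (H _ (Z _ _ Ss)) oppr0 oppr0.
Qed.

End Adjoint.

(** * Positive square roots by iteration *)

Section SquareRoot.
Context {R : realType} {V : hilbertType R}.
Variable A : V -> V.
Hypotheses (A_lin : forall (a : R[i]) x y, A (a *: x + y) = a *: A x + A y)
  (A_sa : forall x y, rin (A x) y = rin x (A y))
  (A_contr : forall x, rnorm (A x) <= rnorm x).

(* [I - lim sqrt_iter n] is a square root of [I - A]: the limit solves
   [2 Y = A + Y ^ 2].  The scalar iteration [sqrt_iter_bound] is the case
   [A = 1] and dominates norms and increments. *)
Fixpoint sqrt_iter n (x : V) : V :=
  if n is m.+1 then (2^-1)%:C *: (A x + sqrt_iter m (sqrt_iter m x)) else 0.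

Fixpoint sqrt_iter_bound n : R :=
  if n is m.+1 then (1 + sqrt_iter_bound m ^+ 2) / 2 else 0.

Local Notation Y := sqrt_iter.
Local Notation y := sqrt_iter_bound.

Lemma sqrt_iter_bound01 n : 0 <= y n <= 1.
Proof.
elim: n => [|n] /=; first by rewrite lexx ler01.
move: (y n) => a /andP[a0 a1]; apply/andP; split; nra.
Qed.

Lemma sqrt_iter_bound_incr n : y n <= y n.+1.
Proof. by have /andP[] := sqrt_iter_bound01 n; rewrite /=; have := sqr_ge0 (1 - y n); nra. Qed.

Lemma sqrt_iter_lin n a u v : Y n (a *: u + v) = a *: Y n u + Y n v.
Proof.
elim: n u v => [|n IH] u v /=; first by rewrite scaler0 addr0.
by rewrite !IH A_lin addrACA -(scalerDr a) [LHS]scalerDr !scalerA (mulrC a).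
Qed.

Lemma sqrt_iterB n u v : Y n (u - v) = Y n u - Y n v.
Proof. by rewrite addrC -scaleN1r sqrt_iter_lin scaleN1r addrC. Qed.

Lemma sqrt_iter_sa n u v : rin (Y n u) v = rin u (Y n v).
Proof.
elim: n u v => [|n IH] u v /=; first by rewrite rin0l rin0r.
by rewrite rinZl rinZr rinDl rinDr A_sa !IH.
Qed.

Let half_norm (u v : V) (p q : R) : rnorm u <= p -> rnorm v <= q ->
  rnorm ((2^-1)%:C *: (u + v)) <= (p + q) / 2.
Proof.
move=> up vq; rewrite rnormZr ger0_norm ?invr_ge0// mulrC ler_wpM2r ?invr_ge0//.
exact: le_trans (ler_rnormD _ _) (lerD up vq).
Qed.

Lemma sqrt_iter_le n u : rnorm (Y n u) <= y n * rnorm u.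
Proof.
elim: n u => [|n IH] u /=; first by rewrite rnorm0 mul0r.
have /andP[y0 _] := sqrt_iter_bound01 n.
rewrite mulrAC mulrDl mul1r; apply: half_norm; first exact: A_contr.
by apply: le_trans (IH _) _; rewrite expr2 -mulrA ler_wpM2l.
Qed.

Lemma sqrt_iter_incr n u : rnorm (Y n.+1 u - Y n u) <= (y n.+1 - y n) * rnorm u.
Proof.
elim: n u => [|n IH] u.
  by rewrite !subr0 /= ; have := sqrt_iter_le 1 u.
(* The difference of squares is split as Y_(n+1) (Y_(n+1) - Y_n) + (Y_(n+1) - Y_n) Y_n, which needs
   no commutation of the iterates; the same splitting for the scalars [y] makes the bounds match
   exactly. *)
have E : Y n.+2 u - Y n.+1 u = (2^-1)%:C *: (Y n.+1 (Y n.+1 u - Y n u)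
    + (Y n.+1 (Y n u) - Y n (Y n u))).
  rewrite sqrt_iterB subrKA.
  by rewrite [in LHS]/= -/(Y n.+1) -scalerBr opprD addrACA subrr add0r.
rewrite E; have /andP[y0 _] := sqrt_iter_bound01 n.
have /andP[y1 _] := sqrt_iter_bound01 n.+1.
rewrite (_ : (y n.+2 - y n.+1) * rnorm u =
  (y n.+1 * ((y n.+1 - y n) * rnorm u) + (y n.+1 - y n) * (y n * rnorm u)) / 2).
  apply: half_norm.
    by apply: le_trans (sqrt_iter_le _ _) _; rewrite ler_wpM2l.
  apply: le_trans (IH _) _; rewrite ler_wpM2l ?sqrt_iter_le//.
  by rewrite subr_ge0 sqrt_iter_bound_incr.
rewrite (_ : y n.+2 = (1 + y n.+1 ^+ 2) / 2)//.
rewrite {2}(_ : y n.+1 = (1 + y n ^+ 2) / 2)//; lra.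
Qed.

Lemma sqrt_iter_diff m n u : (n <= m)%N ->
  rnorm (Y m u - Y n u) <= (y m - y n) * rnorm u.
Proof.
elim: m => [|m IH]; first by rewrite leqn0 => /eqP->; rewrite !subrr rnorm0 mul0r.
rewrite leq_eqVlt => /predU1P[->|]; first by rewrite !subrr rnorm0 mul0r.
rewrite ltnS => /IH h.
apply: le_trans (rnorm_triangle (Y m u) _ _) _.
by rewrite -(subrKA (y m) (y m.+1)) mulrDl lerD// sqrt_iter_incr.
Qed.

(** The scalar bounds converge, so the iterates converge pointwise to a self-adjoint contraction Z
    with 2Z = A + Z^2; then (I - Z)^2 = I - 2Z + Z^2 = I - A. *)
Lemma sqrt_exists : exists D : boundedOp V V,
  (forall x, 0 <= inner (D x) x) /\ (forall x, D (D x) = x - A x).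
Proof.
have ynd : nondecreasing_seq y by apply/nondecreasing_seqP; exact: sqrt_iter_bound_incr.
have ycv : cvgn y.
  apply: nondecreasing_is_cvgn => //; exists 1 => _ [n _ <-].
  by have /andP[] := sqrt_iter_bound01 n.
set l := limn y.
have yl n : y n <= l by exact: nondecreasing_cvgn_le.
have l1 : l <= 1.
  by apply: limr_le => //; apply: nearW => n; have /andP[] := sqrt_iter_bound01 n.
have by0 c : (fun n => (l - y n) * c) @ \oo --> (0 : R).
  rewrite -[X in _ --> X](mul0r c) -(subrr l).
  by apply: cvgM; [apply: cvgB => //; exact: cvg_cst|exact: cvg_cst].
have /choice[Z HZ] : forall x, exists z : V, Y n x @[n --> \oo] --> z.
  move=> x.
  apply/cvg_ex; apply: (@cauchy_rnorm_cvg _ _ _ (fun n => (l - y n) * rnorm x)) => //.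
  move=> m n nm; apply: le_trans (sqrt_iter_diff _ nm) _.
  by rewrite ler_wpM2r ?rnorm_ge0// lerB.
have Zu x z : Y n x @[n --> \oo] --> z -> Z x = z.
  by move=> h; exact: (cvg_unique _ (HZ x) h).
have Zlin a u v : Z (a *: u + v) = a *: Z u + Z v.
  apply: Zu; rewrite (_ : (fun n => _) = (fun n => a *: Y n u + Y n v)).
    by apply: cvgD => //; apply: cvgZl_tmp.
  by apply/funext => n; rewrite sqrt_iter_lin.
have Zle x : rnorm (Z x) <= rnorm x.
  apply: (@ler_cvg_to _ _ _ _ (fun n => rnorm (Y n x)) (fun=> rnorm x)).
  - exact: eventually_filter.
  - exact: cvg_rnorm.
  - exact: cvg_cst.
  - apply: nearW => n; apply: le_trans (sqrt_iter_le _ _) _.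
    by rewrite ler_piMl ?rnorm_ge0//; have /andP[] := sqrt_iter_bound01 n.
(* The recursion passes to the limit because all iterates are contractions, so Y_n Y_n x tends to Z
   Z x. *)
have Zsq x : (2%:R)%:C *: Z x = A x + Z (Z x).
  have YY : Y n (Y n x) @[n --> \oo] --> Z (Z x).
    apply: (@cvg_rnorm_le _ _ _ _ (fun n => rnorm (Y n x - Z x) + rnorm (Y n (Z x) - Z (Z x)))).
      move=> n; apply: le_trans (rnorm_triangle (Y n (Z x)) _ _) _.
      rewrite lerD2r -sqrt_iterB; apply: le_trans (sqrt_iter_le _ _) _.
      by rewrite ler_piMl ?rnorm_ge0//; have /andP[] := sqrt_iter_bound01 n.
    by rewrite -[X in _ --> X](addr0 0); apply: cvgD; apply/cvg_rnormP; exact: HZ.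
  have h : Y n.+1 x @[n --> \oo] --> (2^-1)%:C *: (A x + Z (Z x)).
    by apply: cvgZl_tmp; apply: cvgD => //; exact: cvg_cst.
  have /(cvg_unique _ h) e : Y n.+1 x @[n --> \oo] --> Z x.
    by rewrite (cvg_shiftS (Y ^~ x)).
  by rewrite -[in LHS]e// scalerA -rmorphM divff// scale1r.
have Zsa u v : rin (Z u) v = rin u (Z v).
  have h1 := @cvg_rinl _ _ _ _ v (HZ u).
  have h2 : rin (Y n u) v @[n --> \oo] --> rin u (Z v).
    rewrite (_ : (fun n => _) = (fun n => rin (Y n v) u)).
      by rewrite rinC; exact: cvg_rinl.
    by apply/funext => n; rewrite sqrt_iter_sa rinC.
  by rewrite -(cvg_lim _ h1)// (cvg_lim _ h2).
have ZB u v : Z (u - v) = Z u - Z v.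
  by rewrite addrC -scaleN1r Zlin scaleN1r addrC.
have Z0 : Z 0 = 0 by have := ZB 0 0; rewrite !subrr.
have [||D DE] := @mk_bop R V V (fun x => x - Z x) 2.
- by move=> a u v; rewrite Zlin scalerBr opprD addrACA.
- by move=> x; apply: le_trans (ler_rnormB _ _) _; have := Zle x; lra.
exists D; split=> x.
  (* Nonnegativity in [R[i]] includes a vanishing imaginary part: self-adjointness of Z gives it,
     and |Z x| <= |x| gives the sign. *)
  rewrite DE inner_rin lecE /=; apply/andP; split.
    rewrite oppr_eq0; apply/eqP.
    have Zi : Z ('i *: x) = 'i *: Z x.
      by have := Zlin 'i x 0; rewrite Z0 !addr0.
    have : rin ('i *: (x - Z x)) x = - rin ('i *: (x - Z x)) x.
      rewrite {1}rin_i rinBl Zsa Zi -rinBr -scalerBr rinC; lra.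
    lra.
  rewrite rinBl rinxx subr_ge0; apply: le_trans (rin_le _ _) _.
  by rewrite expr2 ler_wpM2r ?rnorm_ge0.
have ZZ : Z (Z x) = Z x + Z x - A x.
  by rewrite -mulr2n -scaler_nat -(rmorph_nat (real_complex R)) Zsq addrAC subrr add0r.
by rewrite !DE ZB opprB ZZ [X in _ + X]addrAC addrK addrA subrK.
Qed.

End SquareRoot.

Section Defect.
Context {R : realType} {V W : hilbertType R} (C : boundedOp V W).
Hypothesis C_contr : contractive C.

Let C_le x : rnorm (C x) <= rnorm x.
Proof. by rewrite -le_rnorm; exact: C_contr. Qed.

Lemma defectP : (forall x, 0 <= inner (defect C x) x) /\
  (forall x, defect C (defect C x) = x - adjoint C (C x)).
Proof.
apply: (@getPex _ [set D : boundedOp V V | (forall x, 0 <= inner (D x) x) /\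
  (forall x, D (D x) = x - adjoint C (C x))]).
apply: sqrt_exists => [a x y|x y|x].
- by rewrite !linearP.
- by rewrite -rin_adjoint rinC -rin_adjoint rinC.
have [->|x0] := eqVneq (rnorm (adjoint C (C x))) 0; first exact: rnorm_ge0.
have x1 : 0 < rnorm (adjoint C (C x)) by rewrite lt_def x0 rnorm_ge0.
rewrite -(ler_pM2l x1) -expr2 -rinxx -rin_adjoint; apply: le_trans (rin_le _ _) _.
by rewrite ler_pM ?rnorm_ge0 ?C_le.
Qed.

(** On a complex space positivity forces self-adjointness: the form is real on the diagonal, and
    evaluating it at [x + 'i *: y] relates the two off-diagonal terms. *)
Lemma defect_sa x y : rin (defect C x) y = rin x (defect C y).
Proof.
have H z : rin ('i *: defect C z) z = 0.
  by have := defectP.1 z; rewrite inner_rin lecE /= => /andP[/eqP h _]; move: h => /=; lra.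
have ii (z : V) : 'i *: ('i *: z) = - z.
  by rewrite scalerA -expr2 sqr_i scaleN1r.
have := H (x + 'i *: y).
rewrite linearD linearZ /= scalerDr ii !rinDl !rinDr H add0r.
have := H y; rewrite rin_i !rinNl => Hy.
rewrite rin_i ii rinNr opprK Hy addr0.
by move/eqP; rewrite subr_eq0 => /eqP ->; rewrite rinC.
Qed.


Lemma rnorm_defect x : rnorm (defect C x) ^+ 2 = rnorm x ^+ 2 - rnorm (C x) ^+ 2.
Proof. by rewrite -!rinxx defect_sa defectP.2 rinBr -rin_adjoint. Qed.

End Defect.

(** * The partial isometry [omega_bar] *)

Section PartialIsometry.
Context {R : realType}.

Lemma rnorm_sub (V : hilbertType R) (S : closedSubspace V) (x : S) :
  rnorm x = rnorm (sub_val x).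
Proof. by []. Qed.

Lemma rnorm_dsum (V W : normedModType R[i]) (x : dsum V W) :
  rnorm x ^+ 2 = rnorm x.1 ^+ 2 + rnorm x.2 ^+ 2.
Proof.
rewrite [rnorm x]/rnorm dsum_normE /= sqr_sqrtr//.
by rewrite addr_ge0// sqr_ge0.
Qed.

Lemma bop_cvg (V W : normedModType R[i]) (A : boundedOp V W) (u : nat -> V) x :
  u @ \oo --> x -> A (u n) @[n --> \oo] --> A x.
Proof. by move=> ux; apply: continuous_cvg => //; exact: bop_continuous. Qed.

Lemma bopB (V W : normedModType R[i]) (A : boundedOp V W) x y :
  A (x - y) = A x - A y.
Proof. exact: linearB. Qed.

Variables (H E G : hilbertType R) (B : boundedOp H E) (F : boundedOp H G).
Hypothesis BF : forall h, rnorm (B h) = rnorm (F h).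

Local Notation M := (closed_range B).

Lemma closed_range_seq x : carrier M x ->
  exists h : nat -> H, forall n, rnorm (B (h n) - x) <= n.+1%:R^-1.
Proof.
move=> /closure_normP Mx; have /choice[h Hh] : forall n : nat, exists h, rnorm (B h - x) <= n.+1%:R^-1.
  move=> n; have [|_ [h _ <-]] := Mx (n.+1%:R^-1 : R)%:C.
    by rewrite gtr0C invr_gt0.
  by rewrite norm_rnorm ltcR => /ltW xh; exists h; rewrite rnormC.
by exists h.
Qed.

Lemma cvg_rate (V : normedModType R[i]) (u : nat -> V) x :
  (forall n, rnorm (u n - x) <= n.+1%:R^-1) -> u @ \oo --> x.
Proof. by move/cvg_rnorm_le; apply; exact: cvg_harmonic. Qed.

Lemma closed_range_orth d s :
  (forall h, inner d (B h) = 0) -> carrier M s -> inner d s = 0.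
Proof.
move=> dB Ms.
have H0 t : carrier M t -> rin d t = 0.
  move=> /closed_range_seq[h /cvg_rate ht].
  have h1 := @cvg_rinl _ _ _ _ d ht.
  rewrite rinC -(cvg_lim _ h1)//.
  under eq_fun do rewrite rinC /rin dB.
  by rewrite lim_cst.
rewrite inner_rin rin_i H0// H0 ?oppr0//.
by have := carrierP 'i Ms (carrier0 M); rewrite addr0.
Qed.

Lemma range_carrier h : carrier M (B h).
Proof. by apply: subset_closure; exists h. Qed.

(** [w d] is the limit of F h_n for any h_n such that B h_n tends to the projection P d; equality of
    norms makes this limit exist and independent of the sequence. [omega_bar] is the case B = D_X T,
    F = (D_T' X, D_X). *)
Lemma partial_isometry_exists : exists w : boundedOp E G,
  (forall h, w (B h) = F h) /\ (forall d, (forall h, inner d (B h) = 0) -> w d = 0).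
Proof.
have [P PM Pd] : exists2 P : E -> E, (forall d, carrier M (P d)) &
    forall d s, carrier M s -> inner (d - P d) s = 0.
  have /choice[P HP] : forall d, exists p, carrier M p /\
      forall s, carrier M s -> inner (d - p) s = 0.
    by move=> d; have [p] := orthogonal_decomposition M d; exists p.
  by exists P => d; have [] := HP d.
have MB x y : carrier M x -> carrier M y -> carrier M (x - y).
  by move=> Mx My; rewrite addrC -scaleN1r; exact: carrierP.
have P_uniq d p : carrier M p -> (forall s, carrier M s -> inner (d - p) s = 0) -> P d = p.
  move=> Mp dp; apply/eqP; rewrite -subr_eq0; apply/eqP/rnorm0_eq0/eqP.
  have Mpp : carrier M (P d - p) by exact: MB.
  rewrite -sqrf_eq0 -rinxx -{1}(subrKA d) -opprB addrC rinBl /rin dp// Pd//.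
  by rewrite subrr.
have /choice[k /all_and2[kP kF]] : forall d, exists k : (nat -> H) * G,
    (B (k.1 n) @[n --> \oo] --> P d) /\ (F (k.1 n) @[n --> \oo] --> k.2).
  move=> d; have [h hP] := closed_range_seq (PM d).
  suff /cvg_ex[y Fy] : cvgn (fun n => F (h n)) by exists (h, y); split => //; exact: cvg_rate.
  apply: (@cauchy_rnorm_cvg _ _ _ (fun n => 2 * n.+1%:R^-1)); last first.
    by rewrite -[X in _ --> X](mulr0 2); apply: cvgM; [exact: cvg_cst|exact: cvg_harmonic].
  move=> m n nm; rewrite -bopB -BF bopB; apply: le_trans (rnorm_triangle (P d) _ _) _.
  rewrite mulrDl mul1r lerD//; last by rewrite rnormC.
  by apply: le_trans (hP _) _; rewrite lef_pV2 ?posrE// ler_nat ltnS.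
have k_uniq d (h : nat -> H) y : B (h n) @[n --> \oo] --> P d ->
    F (h n) @[n --> \oo] --> y -> (k d).2 = y.
  move=> hP Fy.
  have : rnorm (F ((k d).1 n) - F (h n)) @[n --> \oo] --> (0:R).
    under eq_fun do rewrite -bopB -BF bopB.
    by rewrite -(@rnorm0 _ E) -(subrr (P d)); apply: cvg_rnorm; exact: cvgB.
  move=> h0.
  have h1 : rnorm (F ((k d).1 n) - F (h n)) @[n --> \oo] --> rnorm ((k d).2 - y).
    by apply: cvg_rnorm; exact: cvgB.
  apply/eqP; rewrite -subr_eq0; apply/eqP/rnorm0_eq0.
  by rewrite -(cvg_lim _ h1)// (cvg_lim _ h0).
have [||w wE] := @mk_bop R E G (fun d => (k d).2) 1.
- move=> a x y; apply: (k_uniq _ (fun n => a *: (k x).1 n + (k y).1 n)).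
    rewrite (_ : P _ = a *: P x + P y); last first.
      apply: P_uniq; first exact: carrierP.
      move=> s Ms; rewrite opprD addrACA -scalerBr innerDl inner_Zl !Pd//.
      by rewrite mulr0 addr0.
    under eq_fun do rewrite linearP.
    by apply: cvgD => //; exact: cvgZl_tmp.
  under eq_fun do rewrite linearP.
  by apply: cvgD => //; exact: cvgZl_tmp.
(* By continuity |w x| = |P x|, and |P x| <= |x| because x - P x is orthogonal to P x. *)
- move=> x; rewrite mul1r.
  rewrite -(cvg_lim _ (cvg_rnorm (kF x)))//.
  under eq_fun do rewrite -BF.
  rewrite (cvg_lim _ (cvg_rnorm (kP x)))//.
  rewrite -(ler_pXn2r (n := 2)) ?nnegrE ?rnorm_ge0//.
  have := sqr_ge0 (rnorm (x - P x)); rewrite rnormB_sqr.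
  have : rin (x - P x) (P x) = 0 by rewrite /rin Pd.
  rewrite rinBl rinxx; lra.
exists w; split=> [h|d dB]; rewrite wE.
  apply: (k_uniq _ (fun=> h)); last exact: cvg_cst.
  rewrite (_ : P _ = B h); first exact: cvg_cst.
  by apply: P_uniq; [exact: range_carrier|move=> s _; rewrite subrr linear0l].
apply: (k_uniq _ (fun=> 0)); rewrite linear0; last exact: cvg_cst.
rewrite (_ : P _ = 0); first exact: cvg_cst.
apply: P_uniq; first exact: carrier0.
by move=> s Ms; rewrite subr0; exact: closed_range_orth.
Qed.

Variable w : boundedOp E G.
Hypotheses (wB : forall h, w (B h) = F h)
  (w0 : forall d, (forall h, inner d (B h) = 0) -> w d = 0).

Lemma partial_isometry_norm x : carrier M x -> rnorm (w x) = rnorm x.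
Proof.
move=> /closed_range_seq[h /cvg_rate hx].
have := cvg_rnorm (bop_cvg (A := w) hx); under eq_fun do rewrite wB -BF.
by move=> h1; rewrite -(cvg_lim _ h1)// (cvg_lim _ (cvg_rnorm hx)).
Qed.

Lemma partial_isometry_rin x y : carrier M x -> carrier M y ->
  rin (w x) (w y) = rin x y.
Proof.
move=> Mx My; have := partial_isometry_norm (carrierP 1 Mx My).
rewrite scale1r linearD => e.
have := rnormD_sqr (w x) (w y); rewrite e rnormD_sqr !partial_isometry_norm//.
lra.
Qed.

(** [adjoint w (w d)] is the projection of d on the closed range of [B], because [w] kills the
    orthogonal complement and preserves [rin] on that range. This puts the vector used by
    [proj_kernel] inside the kernel. *)
Lemma partial_isometry_ker d : w (d - adjoint w (w d)) = 0.
Proof.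
have [p Mp dp] := orthogonal_decomposition M d.
have wdp x q : carrier M q -> (forall s, carrier M s -> inner (x - q) s = 0) -> w x = w q.
  move=> Mq xq; apply/eqP; rewrite -subr_eq0 -bopB; apply/eqP/w0 => h.
  exact/xq/range_carrier.
suff -> : adjoint w (w d) = p by rewrite bopB (wdp _ _ Mp dp) subrr.
apply: rin_ext => z; have [q Mq zq] := orthogonal_decomposition M z.
rewrite rinC -rin_adjoint rinC (wdp _ _ Mp dp) (wdp _ _ Mq zq) partial_isometry_rin//.
by apply/eqP; rewrite -subr_eq0 -rinBr rinC -opprB rinNl /rin zq// oppr0.
Qed.

End PartialIsometry.

Lemma rnorm_partial_isometry (R : realType) (V W : hilbertType R) (w : boundedOp V W) d :
  w (d - adjoint w (w d)) = 0 ->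
  rnorm (w d) ^+ 2 = rnorm d ^+ 2 - rnorm (d - adjoint w (w d)) ^+ 2.
Proof.
move=> wq.
have e : rin d (adjoint w (w d)) = rnorm (w d) ^+ 2 by rewrite -rin_adjoint rinxx.
have : rin (d - adjoint w (w d)) (adjoint w (w d)) = 0 by rewrite -rin_adjoint wq rin0l.
rewrite rinBl rinxx e rnormB_sqr e; lra.
Qed.

Section OmegaBar.
Context {R : realType} {H H' : hilbertType R}.
Variables (T' : boundedOp H' H') (T : boundedOp H H) (X : boundedOp H H').
Hypotheses (T'_contraction : contractive T') (T_isometry : isometric T)
  (X_intertwines : forall h, T' (X h) = X (T h)) (X_contraction : contractive X).

Lemma rnorm_to_defect (V W : hilbertType R) (C : boundedOp V W) x : contractive C ->
  rnorm (to_defect C x) ^+ 2 = rnorm x ^+ 2 - rnorm (C x) ^+ 2.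
Proof. by move=> cC; rewrite rnorm_sub/= rnorm_defect. Qed.

Lemma to_defect_lin (V W : hilbertType R) (C : boundedOp V W) (a : R[i]) x y :
  to_defect C (a *: x + y) = a *: to_defect C x + to_defect C y.
Proof. by apply: val_inj => /=; exact: linearP. Qed.

Lemma rnorm_to_defect_le (V W : hilbertType R) (C : boundedOp V W) x :
  contractive C -> rnorm (to_defect C x) <= rnorm x.
Proof.
move=> cC; rewrite -(ler_pXn2r (n := 2)) ?nnegrE ?rnorm_ge0// rnorm_to_defect//.
by rewrite gerBl sqr_ge0.
Qed.

Let omega_maps : exists2 B : boundedOp H (defect_space X),
  (forall h, B h = to_defect X (T h)) & exists2 F : boundedOp H (omega_space T' X),
  (forall h, F h = (to_defect T' (X h), to_defect X h)) &
  forall h, rnorm (B h) = rnorm (F h).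
Proof.
have [||B BE] := @mk_bop R H (defect_space X) (fun h => to_defect X (T h)) 1.
- by move=> a x y; rewrite linearP to_defect_lin.
- move=> x; rewrite mul1r; apply: le_trans (rnorm_to_defect_le _ _) _ => //.
  by rewrite -le_rnorm T_isometry.
(* Both squared norms equal |h|^2 - |T' X h|^2, since T is isometric and X T = T' X. *)
have BF h : rnorm (to_defect X (T h)) =
    rnorm ((to_defect T' (X h), to_defect X h) : omega_space T' X).
  apply/eqP; rewrite -(eqrXn2 (n := 2)) ?rnorm_ge0//; apply/eqP.
  rewrite rnorm_dsum !rnorm_to_defect//= -X_intertwines.
  by rewrite /rnorm T_isometry; lra.
have [||F FE] := @mk_bop R H (omega_space T' X)
    (fun h => (to_defect T' (X h), to_defect X h)) 1.
- by move=> a x y; rewrite linearP !to_defect_lin.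
- move=> x; rewrite -BF mul1r; apply: le_trans (rnorm_to_defect_le _ _) _ => //.
  by rewrite -le_rnorm T_isometry.
by exists B => //; exists F => // h; rewrite BE FE BF.
Qed.

Lemma omega_barP :
  (forall h, omega_bar T' T X (to_defect X (T h)) = (to_defect T' (X h), to_defect X h)) /\
  (forall d, (forall h, inner d (to_defect X (T h)) = 0) -> omega_bar T' T X d = 0).
Proof.
have [B BE [F FE BF]] := omega_maps.
apply: (@getPex _ [set w : boundedOp (defect_space X) (omega_space T' X) |
    (forall h, w (to_defect X (T h)) = (to_defect T' (X h), to_defect X h)) /\
    (forall d, (forall h, inner d (to_defect X (T h)) = 0) -> w d = 0)]).
have [w [wB w0]] := partial_isometry_exists BF.
exists w; split=> [h|d dB]; first by rewrite -BE wB FE.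
by apply: w0 => h; rewrite BE.
Qed.

Lemma omega_bar_ker d :
  omega_bar T' T X (d - adjoint (omega_bar T' T X) (omega_bar T' T X d)) = 0.
Proof.
have [B BE [F FE BF]] := omega_maps; have [wB w0] := omega_barP.
apply: (partial_isometry_ker BF) => [h|e eB]; first by rewrite BE wB FE.
by apply: w0 => h; rewrite -BE; exact: eB.
Qed.

End OmegaBar.

(** * Parseval's identity on circles *)

Section MeanValue.
Context {R : realType}.
Local Notation mu := (@lebesgue_measure R).
Local Notation I := `[0%R, (2 * pi)%R]%classic.

Let mI : measurable (I : set (measurableTypeR R)).
Proof. exact: measurable_itv. Qed.

(** Carrying integrability along with the value lets averages be added, scaled and compared freely;
    [m] is normalised as in [circle_mean]. *)
Definition has_mean (g : R -> R) (m : R) :=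
  mu.-integrable I (fun t => (g t)%:E) /\
  (\int[mu]_(t in I) (g t)%:E)%E = (2 * pi * m)%:E.

Lemma two_pi_gt0 : 0 < 2 * pi :> R.
Proof. by rewrite mulr_gt0// pi_gt0. Qed.

Lemma lebesgue_circle : mu I = (2 * pi)%:E.
Proof. by rewrite lebesgue_measure_itv/= lte_fin two_pi_gt0 oppr0 adde0. Qed.

Let integral_circle_cst c : (\int[mu]_(t in I) c%:E = (2 * pi * c)%:E)%E.
Proof.
rewrite integral_cst//; transitivity (c%:E * mu I)%E => //.
by rewrite lebesgue_circle -EFinM mulrC.
Qed.

Lemma has_mean_cst c : has_mean (fun=> c) c.
Proof.
split; last exact: integral_circle_cst.
apply/integrableP; split; first exact: measurable_cst.
under eq_integral do rewrite abse_EFin.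
by rewrite integral_circle_cst ltry.
Qed.

Lemma has_meanD g h m p : has_mean g m -> has_mean h p ->
  has_mean (fun t => g t + h t) (m + p).
Proof.
move=> [ig Ig] [ih Ih]; split; first exact: (integrableD mI ig ih).
by rewrite (mulrDr (2 * pi)) EFinD -Ig -Ih -(integralD mI ig ih).
Qed.

Lemma has_meanZ c g m : has_mean g m -> has_mean (fun t => c * g t) (c * m).
Proof.
move=> [ig Ig]; split; first exact: (integrableZl mI c ig).
by rewrite (mulrCA (2 * pi)) EFinM -Ig -(integralZl mI ig).
Qed.

Lemma has_meanB g h m p : has_mean g m -> has_mean h p ->
  has_mean (fun t => g t - h t) (m - p).
Proof.
move=> gm /(has_meanZ (-1)) hp; have := has_meanD gm hp.
by under eq_fun do rewrite mulN1r; rewrite mulN1r.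
Qed.

Lemma has_mean_sum n (g : nat -> R -> R) (m : nat -> R) :
  (forall k, (k < n)%N -> has_mean (g k) (m k)) ->
  has_mean (fun t => \sum_(k < n) g k t) (\sum_(k < n) m k).
Proof.
elim: n => [|n IH] H.
  by under eq_fun do rewrite big_ord0; rewrite big_ord0; exact: has_mean_cst.
under eq_fun do rewrite big_ord_recr/=; rewrite big_ord_recr/=.
by apply: has_meanD; [apply: IH => k kn; apply: H; exact: ltnW|exact: H].
Qed.

Lemma has_mean_le g h m p : has_mean g m -> has_mean h p ->
  (forall t, g t <= h t) -> m <= p.
Proof.
move=> [ig Ig] [ih Ih] gh.
rewrite -(ler_pM2l two_pi_gt0) -lee_fin -Ig -Ih.
by apply: le_integral => // t _; rewrite lee_fin.
Qed.

Lemma has_mean_uniq g m p : has_mean g m -> has_mean g p -> m = p.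
Proof. by move=> gm gp; apply/eqP; rewrite eq_le (has_mean_le gm gp)// (has_mean_le gp gm). Qed.

Lemma circle_mean_has_mean (f : R[i] -> R) rho m :
  has_mean (fun t => f (rho%:C * (cos t +i* sin t))) m -> circle_mean f rho = m%:E.
Proof.
move=> [_ If]; rewrite /circle_mean If -EFinM mulrA mulVf ?mul1r//.
by rewrite gt_eqF// two_pi_gt0.
Qed.

(** Dominated convergence; a constant dominates because the interval has finite measure. *)
Lemma has_mean_lim (g : nat -> R -> R) (h : R -> R) (m : nat -> R) (M : R) :
  (forall n, has_mean (g n) (m n)) -> (forall t, g n t @[n --> \oo] --> h t) ->
  (forall n t, `|g n t| <= M) ->
  exists2 p, has_mean h p & m @ \oo --> p.
Proof.
move=> gm gh gM.
have [] := @dominated_convergence _ _ R mu I _ (fun n t => (g n t)%:E) (fun t => (h t)%:E)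
  (fun=> M%:E).
- by [].
- by move=> n; have [/measurable_int] := gm n.
- apply: (emeasurable_fun_cvg (fun n t => (g n t)%:E)).
    by move=> n; have [/measurable_int] := gm n.
  by move=> t _; apply: cvg_EFin; [exact: nearW|exact: gh].
- by apply: aeW => t _; apply: cvg_EFin; [exact: nearW|exact: gh].
- exact: (has_mean_cst M).1.
- by apply: aeW => t n _; rewrite lee_fin.
move=> ih _ cv.
have hfin : (\int[mu]_(t in I) (h t)%:E)%E \is a fin_num by exact: integrable_fin_num.
exists ((2 * pi)^-1 * fine (\int[mu]_(t in I) (h t)%:E)%E).
  by split=> //; rewrite mulVKf ?gt_eqF ?two_pi_gt0// fineK.
have E : m = (fun n => (2 * pi)^-1 * fine (\int[mu]_(t in I) (g n t)%:E)%E).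
  by apply/funext => n; rewrite (gm n).2/= mulKf// gt_eqF// two_pi_gt0.
rewrite E; apply: cvgM; first exact: cvg_cst.
by apply: fine_cvg; rewrite fineK.
Qed.

Lemma has_mean_trig m a b : (0 < m)%N ->
  has_mean (fun t => a * cos (m%:R * t) + b * sin (m%:R * t)) 0.
Proof.
move=> m0.
have mR : m%:R != 0 :> R by rewrite pnatr_eq0 -lt0n.
(* An antiderivative of [f], with equal values at 0 and 2 pi by periodicity. *)
pose F t := m%:R^-1 * (a * sin (m%:R * t) - b * cos (m%:R * t)) : R.
pose f t := a * cos (m%:R * t) + b * sin (m%:R * t) : R.
have Fd (t : R) : is_derive t 1 F (f t).
  have mt (x : R) : is_derive x 1 (fun t => m%:R * t) (m%:R : R).
    have := is_deriveZ (m%:R : R) (is_derive_id x (1 : R)); rewrite /GRing.scale /= mulr1; apply.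
  have cs (x : R) := is_derive1_comp (is_derive_cos (m%:R * x)) (mt x).
  have ss (x : R) := is_derive1_comp (is_derive_sin (m%:R * x)) (mt x).
  have := is_deriveZ (m%:R^-1 : R) (is_deriveB (is_deriveZ a (ss t)) (is_deriveZ b (cs t))).
  rewrite [X in is_derive _ _ _ X](_ : _ = f t); first exact.
  by rewrite /f /GRing.scale /=; field.
have Fc : continuous F.
  by move=> t; apply/differentiable_continuous/derivable1_diffP/ex_derive; exact: Fd.
have fc : continuous f.
  have mc : continuous (fun t : R => m%:R * t) by exact: mulrl_continuous.
  move=> t; apply: cvgD; apply: cvgM; try exact: cvg_cst.
    by apply: continuous_comp; [exact: mc|exact: continuous_cos].
  by apply: continuous_comp; [exact: mc|exact: continuous_sin].
split.
  apply: continuous_compact_integrable; first exact: segment_compact.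
  exact: continuous_subspaceT.
rewrite (@continuous_FTC2 _ f F) ?two_pi_gt0//.
- rewrite mulr0 -EFinB; congr (_%:E).
  have e : m%:R * (2 * pi) = 0 + pi *+ 2 *+ m :> R.
    by rewrite add0r -(mulr_natl pi 2) -(mulr_natl (2 * pi) m).
  by rewrite /F e (periodicn (@sinD2pi R)) (periodicn (@cosD2pi R)) mulr0 subrr.
- exact: continuous_subspaceT.
- split; first by move=> t _; apply: ex_derive; exact: Fd.
    by apply: cvg_at_right_filter; exact: Fc.
  by apply: cvg_at_left_filter; exact: Fc.
- by move=> t _; rewrite derive1E; exact: derive_val.
Qed.

End MeanValue.

Section Parseval.
Context {R : realType}.
Implicit Types V : hilbertType R.

Definition circ (rho t : R) : R[i] := rho%:C * (cos t +i* sin t).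

Lemma circX rho t n :
  circ rho t ^+ n = (rho ^+ n)%:C * (cos (n%:R * t) +i* sin (n%:R * t)).
Proof.
elim: n => [|n IH]; first by rewrite !expr0 mul0r cos0 sin0 mul1r.
rewrite exprS IH /circ exprS -[in RHS]addn1 natrD mulrDl mul1r cosD sinD rmorphM.
rewrite mulrACA; congr (_ * _).
by simpc; congr (_ +i* _); ring.
Qed.

Lemma normr_circ rho t : 0 <= rho -> `|circ rho t| = rho%:C.
Proof.
move=> r0; rewrite /circ normrM !normc_def /= expr0n addr0 sqrtr_sqr ger0_norm//.
by rewrite cos2Dsin2 sqrtr1 mulr1.
Qed.

Lemma rin_scale_same V (c : R[i]) (x y : V) :
  rin (c *: x) (c *: y) = complex.Re `|c| ^+ 2 * rin x y.
Proof.
rewrite /rin inner_Zl inner_Zr mulrA.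
case: c => a b; rewrite normc_def /= sqr_sqrtr ?addr_ge0 ?sqr_ge0//.
by case: (inner x y) => u v /=; ring.
Qed.

(** The common factor z^k contributes rho^(2k) and leaves the single frequency m, which averages to
    0 when m > 0. *)
Lemma rin_circ V rho t k m (x y : V) : 0 <= rho ->
  rin (circ rho t ^+ k *: x) (circ rho t ^+ (k + m) *: y) =
  rho ^+ (2 * k + m) * (complex.Re (inner x y) * cos (m%:R * t) +
    complex.Im (inner x y) * sin (m%:R * t)).
Proof.
move=> r0; rewrite exprD -scalerA rin_scale_same normrX normr_circ// -rmorphXn /=.
rewrite -exprM (mulnC k) exprD -mulrA; congr (_ * _).
rewrite /rin inner_Zr circX.
by case: (inner x y) => u v /=; ring.
Qed.

Definition psum V (z : R[i]) (a : nat -> V) n := \sum_(k < n) z ^+ k *: a k.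

Lemma seriesE V (z : R[i]) (a : nat -> V) :
  series (fun n => z ^+ n *: a n) = psum z a.
Proof. by apply/funext => n; rewrite seriesEord. Qed.

Definition sqsum V (rho : R) (a : nat -> V) n :=
  \sum_(k < n) rho ^+ (2 * k) * rnorm (a k) ^+ 2.

Lemma rnormZX V (rho t : R) n (x : V) : 0 <= rho ->
  rnorm (circ rho t ^+ n *: x) = rho ^+ n * rnorm x.
Proof. by move=> r0; rewrite rnormZ normrX normr_circ// -rmorphXn. Qed.

(** Orthogonality of monomials on a circle, by induction: the new term meets the earlier ones only
    in frequencies n - k > 0, whose mean vanishes. *)
Lemma has_mean_psum V (rho : R) (a : nat -> V) n : 0 <= rho ->
  has_mean (fun t => rnorm (psum (circ rho t) a n) ^+ 2) (sqsum rho a n).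
Proof.
move=> r0; elim: n => [|n IH].
  rewrite /sqsum big_ord0; under eq_fun do rewrite /psum big_ord0 rnorm0 expr0n.
  exact: has_mean_cst.
rewrite /sqsum big_ord_recr /=.
under eq_fun do rewrite /psum big_ord_recr /= rnormD_sqr rnormZX// (exprMn 2 (rho ^+ n)) -exprM (mulnC n).
rewrite -[X in has_mean _ (X + _)]addr0.
apply: has_meanD; last exact: has_mean_cst.
apply: has_meanD; first exact: IH.
rewrite -(mulr0 2); apply: has_meanZ.
have S t : rin (\sum_(k < n) circ rho t ^+ k *: a k) (circ rho t ^+ n *: a n) =
    \sum_(k < n) rho ^+ (2 * k + (n - k)) *
      (complex.Re (inner (a k) (a n)) * cos ((n - k)%:R * t) +
       complex.Im (inner (a k) (a n)) * sin ((n - k)%:R * t)).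
  rewrite (big_morph (fun x => rin x _) (id1 := 0) (op1 := +%R)).
  - by apply: eq_bigr => k _; rewrite -rin_circ// subnKC// ltnW.
  - by move=> x y; rewrite rinDl.
  - by rewrite rin0l.
under eq_fun do rewrite S.
rewrite [X in has_mean _ X](_ : _ = \sum_(k < n) (fun=> 0 : R) (k : nat)); last by rewrite big1.
apply: (has_mean_sum (g := fun k t => rho ^+ (2 * k + (n - k)) *
      (complex.Re (inner (a k) (a n)) * cos ((n - k)%:R * t) +
       complex.Im (inner (a k) (a n)) * sin ((n - k)%:R * t))) (m := fun=> 0)).
move=> k kn; rewrite -(mulr0 (rho ^+ (2 * k + (n - k)))); apply: has_meanZ.
by apply: has_mean_trig; rewrite subn_gt0.
Qed.

Lemma geom_sum_le (q : R) n : 0 <= q -> q < 1 -> \sum_(k < n) q ^+ k <= (1 - q)^-1.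
Proof.
move=> q0 q1; have h : 0 < 1 - q by rewrite subr_gt0.
rewrite -[leRHS]mulr1 -ler_pdivrMl ?invr_gt0// invrK.
rewrite -(opprB q) mulNr -subrX1 opprB.
by rewrite gerBl exprn_ge0.
Qed.

Lemma power_series_coef_bound V (f : R[i] -> V) (a : nat -> V) (r : R) :
  power_series_on_disc f a -> 0 <= r -> r < 1 ->
  exists2 K, 0 <= K & forall n, r ^+ n * rnorm (a n) <= K.
Proof.
move=> fa r0 r1; have := fa r%:C; rewrite normc_def /= expr0n addr0 sqrtr_sqr.
rewrite ger0_norm// ltcR => /(_ r1) cv.
have /cvg_rnormP h := cvg_series_cvg_0 (cvgP _ cv).
have [K K0 HK] := pinfty_ex_gt0 (cvg_seq_bounded (cvgP _ h)).
exists K; first exact: ltW.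
move=> n; have /= := HK n Logic.I; rewrite subr0 ger0_norm ?rnorm_ge0// -rmorphXn rnormZr.
by rewrite ger0_norm// exprn_ge0.
Qed.

Lemma parseval V (f : R[i] -> V) (a : nat -> V) (rho : R) :
  power_series_on_disc f a -> 0 <= rho -> rho < 1 ->
  exists2 p, has_mean (fun t => rnorm (f (circ rho t)) ^+ 2) p &
    sqsum rho a @ \oo --> p.
Proof.
(* Boundedness of the terms at a radius r strictly between rho and 1 dominates the partial sums at
   radius rho by a geometric series of ratio rho / r, uniformly in the angle. *)
move=> fa r0 r1; pose r := (rho + 1) / 2.
have [rr rr0 rr1] : [/\ rho < r, 0 < r & r < 1] by split; rewrite /r; lra.
have [K K0 HK] := power_series_coef_bound fa (ltW rr0) rr1.
have q0 : 0 <= rho / r by rewrite divr_ge0// ltW.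
have q1 : rho / r < 1 by rewrite ltr_pdivrMr// mul1r.
have B t n : rnorm (psum (circ rho t) a n) <= K * (1 - rho / r)^-1.
  apply: le_trans (ler_rnorm_sum _ _ _) _.
  apply: (@le_trans _ _ (\sum_(k < n) K * (rho / r) ^+ k)); last first.
    by rewrite -mulr_sumr ler_wpM2l// geom_sum_le.
  apply: ler_sum => k _; rewrite rnormZX//.
  rewrite (_ : rho ^+ k * _ = (rho / r) ^+ k * (r ^+ k * rnorm (a k))).
    by rewrite mulrC ler_wpM2r// exprn_ge0.
  by rewrite mulrA -exprMn divfK// gt_eqF.
apply: (@has_mean_lim _ (fun n t => rnorm (psum (circ rho t) a n) ^+ 2) _ _
    ((K * (1 - rho / r)^-1) ^+ 2)).
- by move=> n; exact: has_mean_psum.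
- move=> t; have h : rnorm (psum (circ rho t) a n) @[n --> \oo] --> rnorm (f (circ rho t)).
    by apply: cvg_rnorm; rewrite -seriesE; apply: fa; rewrite normr_circ// ltcR.
  rewrite (_ : (fun n => _) =
    (fun n => rnorm (psum (circ rho t) a n) * rnorm (psum (circ rho t) a n))).
    by rewrite expr2; exact: cvgM.
  by apply/funext => n; rewrite expr2.
- move=> n t; rewrite ger0_norm ?sqr_ge0// lerXn2r ?nnegrE ?rnorm_ge0//.
  exact: le_trans (rnorm_ge0 _) (B t n).
Qed.

End Parseval.

(** * Hilbert space valued power series on the disc *)

Section PowerSeries.
Context {R : realType} {V : hilbertType R}.
Implicit Types (f g : R[i] -> V) (a b : nat -> V).

Lemma psumS (z : R[i]) a n : psum z a n.+1 = psum z a n + z ^+ n *: a n.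
Proof. by rewrite /psum big_ord_recr. Qed.

Lemma psum0 (z : R[i]) a : psum z a 0 = 0.
Proof. by rewrite /psum big_ord0. Qed.

Lemma power_seriesP f a : power_series_on_disc f a <->
  forall z : R[i], `|z| < 1 -> psum z a @ \oo --> f z.
Proof. by split=> fa z /fa; rewrite seriesE. Qed.

Lemma power_series_lin (c : R[i]) f g a b :
  power_series_on_disc f a -> power_series_on_disc g b ->
  power_series_on_disc (fun z => c *: f z + g z) (fun n => c *: a n + b n).
Proof.
move=> /power_seriesP fa /power_seriesP gb; apply/power_seriesP => z z1.
rewrite (_ : psum z _ = (fun n => c *: psum z a n + psum z b n)).
  by apply: cvgD; [apply: cvgZl_tmp; exact: fa|exact: gb].
apply/funext; elim=> [|n IH]; first by rewrite !psum0 scaler0 addr0.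
by rewrite !psumS IH !scalerDr !scalerA (mulrC c) addrACA.
Qed.

Lemma power_series_zero : power_series_on_disc (fun=> 0 : V) (fun=> 0).
Proof.
apply/power_seriesP => z z1; rewrite (_ : psum z _ = fun=> 0); first exact: cvg_cst.
by apply/funext; elim=> [|n IH]; rewrite ?psum0// psumS IH scaler0 addr0.
Qed.

Definition shift_coef k a n : V := if (k <= n)%N then a (n - k)%N else 0.

Lemma power_series_shift k f a : power_series_on_disc f a ->
  power_series_on_disc (fun z => z ^+ k *: f z) (shift_coef k a).
Proof.
move=> /power_seriesP fa; apply/power_seriesP => z z1.
rewrite -(cvg_shiftn k) (_ : (fun n => _) = (fun n => z ^+ k *: psum z a n)).
  by apply: cvgZl_tmp; exact: fa.
apply/funext; elim=> [|n IH].
  rewrite add0n psum0 scaler0 /psum big1// => j _.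
  by rewrite /shift_coef leqNgt ltn_ord scaler0.
rewrite addSn !psumS IH scalerDr scalerA -exprD addnC; congr (_ + _ *: _).
by rewrite /shift_coef leq_addr addKn.
Qed.

Lemma normr_re (z : R[i]) : `|z| < 1 ->
  `|z| = (complex.Re `|z|)%:C /\ 0 <= complex.Re `|z| < 1.
Proof.
have e : `|z| = (complex.Re `|z|)%:C by rewrite RRe_real// normr_real.
move=> z1; split=> //; rewrite -lecR -ltcR -e z1 andbT; exact: normr_ge0.
Qed.

(** The coefficients are bounded only from index n on, which is the range where [conv_le] supplies a
    bound. *)
Lemma psum_diff a K n m (z : R[i]) : (forall k, (n <= k)%N -> rnorm (a k) <= K) ->
  `|z| < 1 -> (n <= m)%N ->
  rnorm (psum z a m - psum z a n) <= K * (1 - complex.Re `|z|)^-1 * complex.Re `|z| ^+ n.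
Proof.
move=> aK z1 nm; have [zE /andP[r0 r1]] := normr_re z1.
have K0 : 0 <= K by exact: le_trans (rnorm_ge0 _) (aK n (leqnn n)).
rewrite -(subnKC nm); move: (m - n)%N => {nm}m.
rewrite (_ : psum z a (n + m) - _ = z ^+ n *: psum z (fun k => a (n + k)%N) m); last first.
  elim: m => [|m IH]; first by rewrite addn0 subrr psum0 scaler0.
  by rewrite addnS !psumS addrAC IH scalerDr scalerA -exprD.
rewrite rnormZ normrX zE -rmorphXn /= mulrC ler_wpM2r ?exprn_ge0//.
apply: le_trans (ler_rnorm_sum _ _ _) _.
apply: (@le_trans _ _ (\sum_(k < m) K * complex.Re `|z| ^+ k)); last first.
  by rewrite -mulr_sumr ler_wpM2l// geom_sum_le.
apply: ler_sum => k _; rewrite rnormZ normrX {1}zE -rmorphXn /= mulrC.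
by rewrite ler_wpM2r ?exprn_ge0// aK// leq_addr.
Qed.

Lemma psum_tail f a K n (z : R[i]) : power_series_on_disc f a ->
  (forall k, (n <= k)%N -> rnorm (a k) <= K) -> `|z| < 1 ->
  rnorm (f z - psum z a n) <= K * (1 - complex.Re `|z|)^-1 * complex.Re `|z| ^+ n.
Proof.
move=> /power_seriesP fa aK z1.
have h : rnorm (psum z a m - psum z a n) @[m --> \oo] --> rnorm (f z - psum z a n).
  by apply: cvg_rnorm; apply: cvgB; [exact: fa|exact: cvg_cst].
rewrite -(cvg_lim _ h)//; apply: limr_le; first exact: cvgP h.
by exists n => // m /= nm; exact: psum_diff.
Qed.

Lemma power_series_exists a K : (forall k, rnorm (a k) <= K) ->
  exists f, power_series_on_disc f a.
Proof.
move=> aK.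
have /choice[f fa] : forall z : R[i], exists l : V, `|z| < 1 -> psum z a @ \oo --> l.
  move=> z; have [z1|z1] := boolP (`|z| < 1); last by exists 0.
  have [_ /andP[r0 r1]] := normr_re z1.
  have /cvg_ex[l zl] : cvgn (psum z a); last by exists l.
  apply: (@cauchy_rnorm_cvg _ _ _
      (fun n => K * (1 - complex.Re `|z|)^-1 * complex.Re `|z| ^+ n)).
    by move=> m n nm; apply: psum_diff.
  apply: (@cvg_geometric R (K * (1 - complex.Re `|z|)^-1) (complex.Re `|z|)).
  by rewrite ger0_norm.
by exists f; apply/power_seriesP => z; exact: fa.
Qed.

Lemma sqsumS (rho : R) a n : sqsum rho a n.+1 = sqsum rho a n + rho ^+ (2 * n) * rnorm (a n) ^+ 2.
Proof. by rewrite /sqsum big_ord_recr. Qed.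

Lemma sqsum_nd (rho : R) a : 0 <= rho -> nondecreasing_seq (sqsum rho a).
Proof.
move=> r0; apply/nondecreasing_seqP => n.
by rewrite sqsumS lerDl mulr_ge0 ?sqr_ge0 ?exprn_ge0.
Qed.

Lemma sqsum_ge0 (rho : R) a n : 0 <= rho -> 0 <= sqsum rho a n.
Proof. by move=> r0; apply: sumr_ge0 => k _; rewrite mulr_ge0 ?sqr_ge0 ?exprn_ge0. Qed.

Lemma sqsum_le1 (rho : R) a n : 0 <= rho <= 1 -> sqsum rho a n <= \sum_(k < n) rnorm (a k) ^+ 2.
Proof.
move=> /andP[r0 r1]; apply: ler_sum => k _.
by rewrite ler_piMl ?sqr_ge0// exprn_ile1.
Qed.

Lemma sqsum_le_mean f a rho n p : power_series_on_disc f a -> 0 <= rho -> rho < 1 ->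
  has_mean (fun t => rnorm (f (circ rho t)) ^+ 2) p -> sqsum rho a n <= p.
Proof.
move=> fa r0 r1 hp; have [q hq aq] := parseval fa r0 r1.
rewrite (has_mean_uniq hp hq) -(cvg_lim _ aq)//.
by apply: nondecreasing_cvgn_le; [exact: sqsum_nd|exact: cvgP aq].
Qed.

Lemma sqsum_cvg1 a n :
  sqsum rho a n @[rho --> (1 : R)^'-] --> \sum_(k < n) rnorm (a k) ^+ 2.
Proof.
elim: n => [|n IH].
  by under eq_fun do rewrite /sqsum big_ord0; rewrite big_ord0; exact: cvg_cst.
under eq_fun do rewrite sqsumS; rewrite big_ord_recr /=.
apply: cvgD => //; have h : rho ^+ (2 * n) @[rho --> (1 : R)^'-] --> (1 : R).
  rewrite -[X in _ --> X](expr1n R (2 * n)).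
  by apply: cvg_at_left_filter; exact: (@exprn_continuous R (2 * n) 1).
rewrite -[X in _ --> X]mul1r.
have h2 : rnorm (a n) ^+ 2 @[rho --> (1 : R)^'-] --> rnorm (a n) ^+ 2 by exact: cvg_cst.
exact: (cvgM h h2).
Qed.

(** The difference of the two series sums to zero, and Parseval at radius 1/2 forces each of its
    coefficients to vanish. *)
Lemma power_series_uniq f a b :
  power_series_on_disc f a -> power_series_on_disc f b -> a = b.
Proof.
move=> fa fb; have := power_series_lin (c := -1) fa fb.
pose c n := -1 *: a n + b n; rewrite -/c => fc; apply/funext => n.
have h0 : 0 <= 2^-1 :> R by rewrite invr_ge0.
have h1 : 2^-1 < 1 :> R by lra.
have := sqsum_le_mean n.+1 fc h0 h1 (p := 0).
under eq_fun do rewrite scaleN1r addrC subrr rnorm0 expr0n.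
move=> /(_ (has_mean_cst 0)); rewrite sqsumS => hle.
have : 2^-1 ^+ (2 * n) * rnorm (c n) ^+ 2 <= 0 :> R.
  by apply: le_trans hle; rewrite lerDr sqsum_ge0.
rewrite pmulr_rle0 ?exprn_gt0 ?invr_gt0// => c0.
have /eqP : rnorm (c n) ^+ 2 == 0 by rewrite eq_le c0 sqr_ge0.
move/eqP; rewrite sqrf_eq0 => /eqP/rnorm0_eq0.
by rewrite /c scaleN1r addrC => /eqP; rewrite subr_eq0 => /eqP.
Qed.

End PowerSeries.

(** * Schur functions *)

Section DirectSumSeries.
Context {R : realType} {E F : hilbertType R}.

Lemma cvg_snd (u : nat -> dsum F E) (l : dsum F E) : u @ \oo --> l -> (u n).2 @[n --> \oo] --> l.2.
Proof.
move=> /cvg_rnormP ul; apply: cvg_rnorm_le ul => n.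
by rewrite -le_rnorm; exact: (dsum_norm_snd (u n - l)).
Qed.

Lemma cvg_fst (u : nat -> dsum F E) (l : dsum F E) : u @ \oo --> l -> (u n).1 @[n --> \oo] --> l.1.
Proof.
move=> /cvg_rnormP ul; apply: cvg_rnorm_le ul => n.
by rewrite -le_rnorm; exact: (dsum_norm_fst (u n - l)).
Qed.

Lemma psum_fst z (a : nat -> dsum F E) n : (psum z a n).1 = psum z (fun k => (a k).1) n.
Proof. by elim: n => [|n IH]; rewrite ?psum0// !psumS -IH. Qed.

End DirectSumSeries.

Section SchurClass.
Context {R : realType} {E F : hilbertType R}.
Variables (W : R[i] -> E -> dsum F E) (Wn : nat -> E -> dsum F E).
Hypotheses (W_series : forall x, power_series_on_disc (W ^~ x) (Wn ^~ x))
  (W_lin : forall z (a : R[i]) x y, W z (a *: x + y) = a *: W z x + W z y)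
  (Wn_lin : forall n (a : R[i]) x y, Wn n (a *: x + y) = a *: Wn n x + Wn n y)
  (W_contr : forall z x, `|z| < 1 -> rnorm (W z x) <= rnorm x).
Implicit Types (c : nat -> E) (d x y : E).

Let W0 z : W z 0 = 0.
Proof. by have := W_lin z (-1) 0 0; rewrite scaleN1r oppr0 addr0 scaleN1r addNr. Qed.

Let WD z x y : W z (x + y) = W z x + W z y.
Proof. by have := W_lin z 1 x y; rewrite !scale1r. Qed.

Let WZ z a x : W z (a *: x) = a *: W z x.
Proof. by have := W_lin z a x 0; rewrite W0 !addr0. Qed.

Let WB z x y : W z (x - y) = W z x - W z y.
Proof. by rewrite WD -scaleN1r WZ scaleN1r. Qed.

(* Coefficients of [W(z) p(z)], where [p(z) = \sum_(k < N) z ^ k c_k]. *)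
Definition conv N c n : dsum F E := \sum_(k < N) shift_coef k (Wn ^~ (c k)) n.

Lemma convS N c n : conv N.+1 c n = conv N c n + shift_coef N (Wn ^~ (c N)) n.
Proof. by rewrite /conv big_ord_recr. Qed.

Lemma conv_series N c : power_series_on_disc (fun z => W z (psum z c N)) (conv N c).
Proof.
elim: N => [|N IH].
  rewrite (_ : conv 0 c = fun=> 0); last by apply/funext => n; rewrite /conv big_ord0.
  under eq_fun do rewrite psum0 W0; exact: power_series_zero.
have := power_series_lin (c := 1) IH (power_series_shift (k := N) (@W_series (c N))).
under eq_fun do rewrite scale1r -WZ -WD -psumS.
by under [X in power_series_on_disc _ X]eq_fun do rewrite scale1r -convS.
Qed.

(** Causality: a term z^k c_k with k > n does not reach the coefficient of index n. *)
Lemma conv_stable N M c n : (n < N)%N -> (N <= M)%N -> conv M c n = conv N c n.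
Proof.
move=> nN /subnKC <-; elim: (M - N)%N => [|m IH]; first by rewrite addn0.
by rewrite addnS convS IH /shift_coef leqNgt (leq_trans nN) ?leq_addr// addr0.
Qed.

(** On each circle |W p| <= |p|, so Parseval compares the weighted sums; both are finite sums, hence
    rho may tend to 1. *)
Lemma toeplitz_contraction N c n :
  \sum_(j < n) rnorm (conv N c j) ^+ 2 <= \sum_(k < N) rnorm (c k) ^+ 2.
Proof.
apply: (@ler_cvg_to _ _ _ _ (fun rho => sqsum rho (conv N c) n) (fun rho => sqsum rho c N)).
- exact: (@at_left_proper_filter R 1).
- exact: sqsum_cvg1.
- exact: sqsum_cvg1.
near=> rho.
have r0 : 0 <= rho by near: rho; exact: nbhs_left_ge.
have r1 : rho < 1 by near: rho; exact: nbhs_left_lt.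
have [p hp _] := parseval (@conv_series N c) r0 r1.
apply: le_trans (sqsum_le_mean n (@conv_series N c) r0 r1 hp) _.
apply: has_mean_le hp (has_mean_psum c N r0) _ => t.
by rewrite lerXn2r ?nnegrE ?rnorm_ge0// W_contr// normr_circ// ltcR.
Unshelve. all: by end_near. Qed.

(** Course-of-values recursion: d_(n+1) depends on all earlier d_k, so stage n stores them as a
    function, whose values beyond index n merely repeat d_n. *)
Fixpoint resolvent_history d n : nat -> E :=
  if n is m.+1 then fun k => if (k <= m)%N then resolvent_history d m k
    else (conv m.+1 (resolvent_history d m) m).2 else fun=> d.

(* [d_0 = d] and [d_(n+1)] is the [n]-th coefficient of [A(z) d(z)]. *)
Definition resolvent_coef d n := resolvent_history d n n.

Lemma resolvent_historyE d n k : (k <= n)%N -> resolvent_history d n k = resolvent_coef d k.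
Proof.
elim: n => [|n IH]; first by rewrite leqn0 => /eqP->.
by rewrite leq_eqVlt => /predU1P[->//|]; rewrite ltnS /= => kn; rewrite kn IH.
Qed.

Lemma conv_ext N c1 c2 n : (forall k, (k < N)%N -> c1 k = c2 k) -> conv N c1 n = conv N c2 n.
Proof. by move=> e; apply: eq_bigr => k _; rewrite e. Qed.

Definition W_coef d n := conv n.+1 (resolvent_coef d) n.

Lemma resolvent_coefS d n : resolvent_coef d n.+1 = (W_coef d n).2.
Proof.
rewrite {1}/resolvent_coef /= ltnn; congr (snd _); apply: conv_ext => k.
by rewrite ltnS; exact: resolvent_historyE.
Qed.

Lemma W_coefE d N n : (n < N)%N -> conv N (resolvent_coef d) n = W_coef d n.
Proof. by move=> nN; rewrite (conv_stable (N := n.+1)). Qed.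

(** Apply the Toeplitz inequality to the polynomial with coefficients d_k, k < N. Its first N
    outputs are (gamma_j, d_(j+1)), so the shared |d_k|^2 cancel and leave |d|^2 against |d_N|^2.
    The outputs from index N on are kept for [conv_le]. *)
Lemma energy_le d N n : (N <= n)%N ->
  \sum_(k < N) rnorm (W_coef d k).1 ^+ 2 + rnorm (resolvent_coef d N) ^+ 2 +
  \sum_(N <= j < n) rnorm (conv N (resolvent_coef d) j) ^+ 2 <= rnorm d ^+ 2.
Proof.
move=> Nn; have := toeplitz_contraction N (resolvent_coef d) n.
have -> : \sum_(j < n) rnorm (conv N (resolvent_coef d) j) ^+ 2 =
    \sum_(j < N) rnorm (conv N (resolvent_coef d) j) ^+ 2 +
    \sum_(N <= j < n) rnorm (conv N (resolvent_coef d) j) ^+ 2.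
  rewrite -(big_mkord xpredT (fun j => rnorm (conv N (resolvent_coef d) j) ^+ 2)).
  by rewrite (@big_cat_nat _ _ _ N)//= big_mkord.
have -> : \sum_(j < N) rnorm (conv N (resolvent_coef d) j) ^+ 2 =
    \sum_(j < N) rnorm (W_coef d j).1 ^+ 2 + \sum_(j < N) rnorm (resolvent_coef d j.+1) ^+ 2.
  by rewrite -big_split; apply: eq_bigr => j _; rewrite W_coefE// rnorm_dsum resolvent_coefS.
have : \sum_(k < N) rnorm (resolvent_coef d k) ^+ 2 + rnorm (resolvent_coef d N) ^+ 2 =
    rnorm d ^+ 2 + \sum_(k < N) rnorm (resolvent_coef d k.+1) ^+ 2.
  rewrite -(big_ord_recr N (fun k => rnorm (resolvent_coef d k) ^+ 2)).
  by rewrite big_ord_recl.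
lra.
Qed.

Lemma energy d N :
  \sum_(k < N) rnorm (W_coef d k).1 ^+ 2 + rnorm (resolvent_coef d N) ^+ 2 <= rnorm d ^+ 2.
Proof. by have := energy_le d (leqnn N); rewrite big_geq// addr0. Qed.

Lemma resolvent_coef_le d n : rnorm (resolvent_coef d n) <= rnorm d.
Proof.
rewrite -(ler_pXn2r (n := 2)) ?nnegrE ?rnorm_ge0//.
apply: le_trans (energy d n); rewrite lerDr sumr_ge0// => k _; exact: sqr_ge0.
Qed.

Lemma conv_le d N n : (N <= n)%N -> rnorm (conv N (resolvent_coef d) n) <= rnorm d.
Proof.
move=> Nn; rewrite -(ler_pXn2r (n := 2)) ?nnegrE ?rnorm_ge0//.
apply: le_trans (energy_le d (leqW Nn)).
rewrite big_nat_recr//= addrA lerDr !addr_ge0 ?sqr_ge0//.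
  by apply: sumr_ge0 => k _; exact: sqr_ge0.
by apply: sumr_ge0 => k _; exact: sqr_ge0.
Qed.

Lemma psum_W_coef d N z : psum z (conv N (resolvent_coef d)) N = psum z (W_coef d) N.
Proof. by apply: eq_bigr => k _; rewrite W_coefE. Qed.

Section Resolvent.
Variables (d : E) (D : R[i] -> E).
Hypothesis D_series : power_series_on_disc D (resolvent_coef d).

(** Truncate d(z) to n terms p_n: W(z) p_n differs from the partial sum of [W_coef] by a geometric
    tail, and contractivity of W(z) controls the error W(z)(p_n - D z). *)
Lemma W_coef_series : power_series_on_disc (fun z => W z (D z)) (W_coef d).
Proof.
apply/power_seriesP => z z1; have [_ /andP[q0 q1]] := normr_re z1.
have /power_seriesP/(_ z z1)/cvg_rnormP Dz := D_series.
pose b n := rnorm d * (1 - complex.Re `|z|)^-1 * complex.Re `|z| ^+ n.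
apply: (cvg_rnorm_le (b := fun n => b n + rnorm (psum z (resolvent_coef d) n - D z))).
  move=> n; apply: le_trans (rnorm_triangle (W z (psum z (resolvent_coef d) n)) _ _) _.
  apply: lerD; last by rewrite -WB W_contr.
  rewrite rnormC -psum_W_coef; apply: (psum_tail (@conv_series n (resolvent_coef d))) => //.
  by move=> k; exact: conv_le.
rewrite -[X in _ --> X](addr0 0); apply: cvgD => //.
by apply: cvg_geometric; rewrite ger0_norm.
Qed.

(** By [resolvent_coefS], multiplying the second component by z gives the series of [D] without its
    constant term d. *)
Lemma resolvent_eq z : `|z| < 1 -> D z - z *: (W z (D z)).2 = d.
Proof.
move=> z1; have /power_seriesP/(_ z z1) Wz := W_coef_series.
have /power_seriesP/(_ z z1) Dz := D_series.
have h1 : z *: (psum z (W_coef d) n).2 @[n --> \oo] --> z *: (W z (D z)).2.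
  by apply: cvgZl_tmp; exact: cvg_snd.
have h2 : z *: (psum z (W_coef d) n).2 @[n --> \oo] --> D z - d.
  rewrite (_ : (fun n => _) = (fun n => psum z (resolvent_coef d) n.+1 - d)).
    by apply: cvgB; [rewrite (cvg_shiftS (psum z (resolvent_coef d)))|exact: cvg_cst].
  apply/funext; elim=> [|n IH].
    by rewrite psum0 psumS psum0 scaler0 add0r expr0 scale1r subrr.
  have -> : (psum z (W_coef d) n.+1).2 = (psum z (W_coef d) n).2 + z ^+ n *: resolvent_coef d n.+1.
    by rewrite psumS resolvent_coefS.
  by rewrite psumS addrAC -IH scalerDr scalerA -exprS.
have -> : z *: (W z (D z)).2 = D z - d by apply: cvg_unique h1 h2.
by rewrite opprB addrC subrK.
Qed.

Lemma Gamma_series : power_series_on_disc (fun z => (W z (D z)).1) (fun n => (W_coef d n).1).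
Proof.
apply/power_seriesP => z z1; have /power_seriesP/(_ z z1) Wz := W_coef_series.
rewrite (_ : psum _ _ = fun n => (psum z (W_coef d) n).1); first exact: cvg_fst.
by apply/funext => n; rewrite psum_fst.
Qed.

(** Abel mean of |d_(k+1)|^2: the first K terms are at most |d|^2 each, the later ones at most e,
    and (1 - rho^2) sum rho^(2k) <= 1. *)
Let q_bound (rho : R) (K : nat) (e : R) M : 0 <= rho -> rho < 1 -> 0 <= e ->
  (forall k, (K <= k)%N -> rnorm (resolvent_coef d k.+1) ^+ 2 <= e) ->
  (1 - rho ^+ 2) * sqsum rho (fun k => resolvent_coef d k.+1) M <=
  (1 - rho ^+ 2) * (K%:R * rnorm d ^+ 2) + e.
Proof.
move=> r0 r1 e0 dK.
have q0 : 0 <= rho ^+ 2 by exact: sqr_ge0.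
have q1 : rho ^+ 2 < 1 by rewrite exprn_ilt1.
have q2 : 0 < 1 - rho ^+ 2 by rewrite subr_gt0.
have d0 := sqr_ge0 (rnorm d).
(* [minn M K] counts the early terms among the first M, which makes the bound provable by induction
   on M. *)
suff : sqsum rho (fun k => resolvent_coef d k.+1) M <=
    (minn M K)%:R * rnorm d ^+ 2 + e * \sum_(k < M) (rho ^+ 2) ^+ k.
  have h := geom_sum_le M q0 q1.
  move=> /(ler_wpM2l (ltW q2)) /le_trans; apply.
  rewrite mulrDr lerD//.
    apply: ler_wpM2l; first exact: ltW.
    by rewrite ler_wpM2r// ler_nat geq_minr.
  by rewrite mulrCA ler_piMr// mulrC -ler_pdivlMr// div1r.
elim: M => [|M IH]; first by rewrite /sqsum !big_ord0 min0n mul0r mulr0 addr0.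
rewrite sqsumS big_ord_recr /= mulrDr addrA.
have r01 : 0 <= rho ^+ (2 * M) by exact: exprn_ge0.
have r11 : rho ^+ (2 * M) <= 1 by rewrite exprn_ile1// ltW.
have [MK|KM] := ltnP M K.
  have -> : minn M.+1 K = (minn M K).+1 by rewrite (minn_idPl MK) (minn_idPl (ltnW MK)).
  have -> : (minn M K).+1%:R = (minn M K)%:R + 1 :> R by rewrite natr1.
  rewrite mulrDl mul1r.
  have : rho ^+ (2 * M) * rnorm (resolvent_coef d M.+1) ^+ 2 <= rnorm d ^+ 2.
    apply: (@le_trans _ _ (rnorm (resolvent_coef d M.+1) ^+ 2)).
      by rewrite ler_piMl ?sqr_ge0.
    by rewrite lerXn2r ?nnegrE ?rnorm_ge0 ?resolvent_coef_le.
  have : 0 <= e * (rho ^+ 2) ^+ M by rewrite mulr_ge0 ?exprn_ge0.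
  lra.
rewrite (minn_idPr (leqW KM)); rewrite (minn_idPr KM) in IH.
apply: lerD => //; rewrite -exprM mulrC; apply: ler_wpM2r => //; exact: dK.
Qed.

(** The two inequalities are the halves of the mean identity that serve the two implications: the
    upper bound drops the Abel term, the lower bound estimates it by [q_bound]. *)
Lemma defect_mean (rho : R) : 0 <= rho -> rho < 1 -> exists m,
  [/\ has_mean (fun t => rnorm (D (circ rho t)) ^+ 2 -
        rnorm (W (circ rho t) (D (circ rho t))) ^+ 2) m,
      forall N, m <= rnorm d ^+ 2 - sqsum rho (fun n => (W_coef d n).1) N &
      forall K e G, 0 <= e ->
        (forall k, (K <= k)%N -> rnorm (resolvent_coef d k.+1) ^+ 2 <= e) ->
        (forall N, \sum_(k < N) rnorm (W_coef d k).1 ^+ 2 <= G) ->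
        rnorm d ^+ 2 <= m + G + (1 - rho ^+ 2) * (K%:R * rnorm d ^+ 2) + e].
Proof.
move=> r0 r1.
have [p1 hp1 cp1] := parseval D_series r0 r1.
have [p2 hp2 cp2] := parseval W_coef_series r0 r1.
have q1 : rho ^+ 2 <= 1 by rewrite exprn_ile1// ltW.
exists (p1 - p2).
(* One more term is taken for d(z) than for W(z) d(z): d_N pairs with the second component of index
   N - 1, so [uE] is exact for every N. *)
pose u N := sqsum rho (resolvent_coef d) N.+1 - sqsum rho (W_coef d) N.
have uc : u @ \oo --> p1 - p2.
  by apply: cvgB => //; rewrite (cvg_shiftS (sqsum rho (resolvent_coef d))).
have uE N : u N = rnorm d ^+ 2 -
    (1 - rho ^+ 2) * sqsum rho (fun k => resolvent_coef d k.+1) N -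
    sqsum rho (fun n => (W_coef d n).1) N.
  rewrite /u; elim: N => [|N IH].
    by rewrite sqsumS /sqsum !big_ord0 mulr0 !subr0 add0r mul1r.
  rewrite sqsumS (sqsumS _ (W_coef d)) !(sqsumS _ (fun=> _)) rnorm_dsum -resolvent_coefS.
  have -> : (2 * N.+1 = 2 * N + 2)%N by rewrite mulnS addnC.
  rewrite exprD; move: IH; rewrite (sqsumS _ _ N); lra.
split; first exact: has_meanB.
- move=> N; rewrite -(cvg_lim _ uc)//; apply: limr_le; first exact: cvgP uc.
  exists N => // M /= NM; rewrite uE.
  have := sqsum_nd (fun n => (W_coef d n).1) r0 NM.
  have : 0 <= (1 - rho ^+ 2) * sqsum rho (fun k => resolvent_coef d k.+1) M.
    by rewrite mulr_ge0 ?sqsum_ge0// subr_ge0.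
  lra.
- move=> K e G e0 dK WG.
  suff : rnorm d ^+ 2 - G - (1 - rho ^+ 2) * (K%:R * rnorm d ^+ 2) - e <= p1 - p2 by lra.
  rewrite -(cvg_lim _ uc)//; apply: limr_ge; first exact: cvgP uc.
  apply: nearW => M; rewrite uE.
  have := q_bound M r0 r1 e0 dK.
  have : sqsum rho (fun n => (W_coef d n).1) M <= G.
    by apply: le_trans (WG M); apply: sqsum_le1; rewrite r0 ltW.
  lra.
Qed.

End Resolvent.

(** The difference satisfies x - y = z A(z)(x - y), whose norm is at most |z| |x - y| with |z| <
    1. *)
Lemma resolvent_uniq z x y : `|z| < 1 ->
  x - z *: (W z x).2 = y - z *: (W z y).2 -> x = y.
Proof.
move=> z1 xy; have [zE /andP[q0 q1]] := normr_re z1.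
have e : x - y = z *: (W z (x - y)).2.
  rewrite WB scalerBr; move: xy; set p := z *: _; set q := z *: _ => xy.
  apply/eqP; rewrite subr_eq -(subrK p x) xy.
  by rewrite addrAC (addrC y) addrAC.
apply/eqP; rewrite -subr_eq0; apply/eqP/rnorm0_eq0/eqP.
have h : rnorm (x - y) <= complex.Re `|z| * rnorm (x - y).
  rewrite {1}e rnormZ ler_wpM2l//; apply: le_trans (W_contr _ z1).
  by rewrite -le_rnorm; exact: dsum_norm_snd.
rewrite eq_le rnorm_ge0 andbT leNgt; apply/negP => p.
by move: h; rewrite leNgt gtr_pMl// q1.
Qed.

Lemma conv_lin N a c1 c2 n :
  conv N (fun k => a *: c1 k + c2 k) n = a *: conv N c1 n + conv N c2 n.
Proof.
elim: N => [|N IH]; first by rewrite /conv !big_ord0 scaler0 addr0.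
rewrite !convS IH scalerDr addrACA; congr (_ + _).
by rewrite /shift_coef; case: ifP => _; rewrite ?Wn_lin// scaler0 addr0.
Qed.

Lemma resolvent_coef_lin a x y n :
  resolvent_coef (a *: x + y) n = a *: resolvent_coef x n + resolvent_coef y n.
Proof.
elim/ltn_ind: n => -[//|n] IH; rewrite !resolvent_coefS /W_coef.
rewrite (@conv_ext _ _ (fun k => a *: resolvent_coef x k + resolvent_coef y k)) ?conv_lin//.
Qed.

Lemma W_coef_lin a x y n : W_coef (a *: x + y) n = a *: W_coef x n + W_coef y n.
Proof.
rewrite /W_coef -conv_lin; apply: conv_ext => k _; exact: resolvent_coef_lin.
Qed.

End SchurClass.

(** * Contractivity and Taylor series of W(z) *)

Section SchurFunction.
Context {R : realType} {H H' : hilbertType R}.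
Variables (T' : boundedOp H' H') (T : boundedOp H H) (X : boundedOp H H').
Hypotheses (T'_contraction : contractive T') (T_isometry : isometric T)
  (X_intertwines : forall h, T' (X h) = X (T h)) (X_contraction : contractive X).
Local Notation w := (omega_bar T' T X).
Variable S : R[i] -> boundedOp (op_kernel w) (op_kernel (adjoint w)).
Implicit Types (d x y : defect_space X).

Local Notation P := (proj_kernel w).
Local Notation W := (schur_W S).

Lemma proj_kernelE d : sub_val (P d) = d - adjoint w (w d).
Proof.
rewrite /proj_kernel; apply: (insubdK (0 : op_kernel w)).
by apply/asboolP; exact: omega_bar_ker.
Qed.

Lemma proj_kernel_lin (a : R[i]) x y : P (a *: x + y) = a *: P x + P y.
Proof.
apply: val_inj; transitivity (a *: sub_val (P x) + sub_val (P y)); last by [].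
by rewrite /= !proj_kernelE (linearP w) (linearP (adjoint w)) scalerBr opprD addrACA.
Qed.

Lemma schur_W_lin z (a : R[i]) x y : W z (a *: x + y) = a *: W z x + W z y.
Proof.
rewrite /schur_W proj_kernel_lin (linearP w) (linearP (S z)) scalerDr addrACA.
by [].
Qed.

Lemma rnorm_schur_W z d : contractive (S z) ->
  rnorm (W z d) ^+ 2 = rnorm d ^+ 2 - rnorm (defect (S z) (P d)) ^+ 2.
Proof.
move=> Sz; rewrite rnormD_sqr.
(* Values of [S z] lie in the kernel of [adjoint w], so they are orthogonal to the range of [w]. *)
have -> : rin (w d) (sub_val (S z (P d))) = 0.
  rewrite rin_adjoint; have := valP (S z (P d)); rewrite /= => /asboolP ->.
  exact: rin0r.
rewrite mulr0 addr0 (rnorm_defect Sz) -rnorm_sub.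
have -> : rnorm (P d) = rnorm (d - adjoint w (w d)) by rewrite rnorm_sub proj_kernelE.
have wd := rnorm_partial_isometry
  (omega_bar_ker T'_contraction T_isometry X_intertwines X_contraction d).
rewrite wd; lra.
Qed.

Lemma schur_W_contr z d : contractive (S z) -> rnorm (W z d) <= rnorm d.
Proof.
move=> Sz; rewrite -(ler_pXn2r (n := 2)) ?nnegrE ?rnorm_ge0// rnorm_schur_W//.
by rewrite gerBl sqr_ge0.
Qed.

Variable Sn : nat -> boundedOp (op_kernel w) (op_kernel (adjoint w)).
Hypothesis S_series : forall y : op_kernel w,
    power_series_on_disc (fun z => S z y) (fun n => Sn n y).

Definition schur_W_coef n d : omega_space T' X :=
  (if n is 0 then w d else 0) + sub_val (Sn n (P d)).

Lemma schur_W_coef_lin n (a : R[i]) x y :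
  schur_W_coef n (a *: x + y) = a *: schur_W_coef n x + schur_W_coef n y.
Proof.
rewrite /schur_W_coef proj_kernel_lin scalerDr.
have -> : sub_val (Sn n (a *: P x + P y)) = a *: sub_val (Sn n (P x)) + sub_val (Sn n (P y)).
  by rewrite linearP.
rewrite addrACA; congr (_ + _).
by case: n => [|n]; [exact: (linearP w)|rewrite scaler0 addr0].
Qed.

Lemma schur_W_series d : power_series_on_disc (W ^~ d) (schur_W_coef ^~ d).
Proof.
apply/power_seriesP => z z1.
have /power_seriesP/(_ z z1)/cvg_rnormP Sz := @S_series (P d).
(* After this shift every partial sum contains the constant term [w d]. *)
rewrite -(cvg_shiftS (psum z _)) /=.
have e n : psum z (schur_W_coef ^~ d) n.+1 = w d + sub_val (psum z (fun n => Sn n (P d)) n.+1).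
  elim: n => [|n IH].
    by rewrite !psumS !psum0 !add0r expr0 !scale1r.
  rewrite psumS IH [in RHS]psumS /schur_W_coef add0r -addrA.
  by [].
under eq_fun do rewrite e.
apply: cvgD; first exact: cvg_cst.
apply/cvg_rnormP; rewrite (cvg_shiftS (fun n => rnorm (sub_val (psum z _ n) - _))).
exact: Sz.
Qed.

End SchurFunction.

Section Isometry.
Context {R : realType} {H H' : hilbertType R}.
Variables (T' : boundedOp H' H') (T : boundedOp H H) (X : boundedOp H H').
Hypotheses (T'_contraction : contractive T') (T_isometry : isometric T)
  (X_intertwines : forall h, T' (X h) = X (T h)) (X_contraction : contractive X).
Local Notation w := (omega_bar T' T X).
Variable S : R[i] -> boundedOp (op_kernel w) (op_kernel (adjoint w)).
Variable Sn : nat -> boundedOp (op_kernel w) (op_kernel (adjoint w)).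
Hypotheses
  (S_series : forall y : op_kernel w,
    power_series_on_disc (fun z => S z y) (fun n => Sn n y))
  (S_contr : forall z, `|z| < 1 -> contractive (S z)).
Local Notation P := (proj_kernel w).
Local Notation W := (schur_W S).
Local Notation Wn := (schur_W_coef Sn).
Local Notation E := (defect_space X).
Implicit Types (d x y : E).

Let W_series := schur_W_series S_series.
Let W_lin := schur_W_lin T'_contraction T_isometry X_intertwines X_contraction S.
Let Wn_lin := schur_W_coef_lin T'_contraction T_isometry X_intertwines X_contraction Sn.
Let W_contr z d (z1 : `|z| < 1) : rnorm (W z d) <= rnorm d :=
  schur_W_contr T'_contraction T_isometry X_intertwines X_contraction d (S_contr z1).

Local Notation dn := (resolvent_coef Wn).
Local Notation gam d := (fun n => (W_coef Wn d n).1).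

(** The recursive coefficients are bounded by |d|, so their series [D] exists on the disc and solves
    the resolvent equation; injectivity of I - zA(z) makes [pinv] return D z. *)
Lemma schur_resolventP d : exists D : R[i] -> E,
  [/\ power_series_on_disc D (dn d),
      forall z, `|z| < 1 -> schur_resolvent S z d = D z &
      power_series_on_disc (schur_resolvent S ^~ d) (dn d)].
Proof.
have [D Ds] := power_series_exists (resolvent_coef_le W_series W_lin W_contr d).
have e z : `|z| < 1 -> schur_resolvent S z d = D z.
  move=> z1; rewrite -{1}(resolvent_eq W_series W_lin W_contr Ds z1).
  rewrite /schur_resolvent.
  apply: (@pinvKV _ _ _ setT (fun d : E => d - z *: schur_A S z d)); rewrite ?in_setT//.
  by move=> x y _ _; exact: (resolvent_uniq W_lin W_contr z1).
exists D; split=> // z z1; rewrite e//; exact: Ds.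
Qed.

Lemma schur_Gamma_series d :
  power_series_on_disc (schur_Gamma S ^~ d) (gam d).
Proof.
have [D [Ds De _]] := schur_resolventP d.
move=> z z1; rewrite /schur_Gamma De//.
exact: (Gamma_series W_series W_lin W_contr Ds).
Qed.

Lemma circle_meanP d (rho : R) : 0 <= rho -> rho < 1 -> exists2 m,
  circle_mean (fun z => rnorm (defect (S z) (P (schur_resolvent S z d))) ^+ 2) rho = m%:E &
  [/\ 0 <= m,
      forall N, m <= rnorm d ^+ 2 - sqsum rho (gam d) N &
      forall K e G, 0 <= e ->
        (forall k, (K <= k)%N -> rnorm (dn d k.+1) ^+ 2 <= e) ->
        (forall N, \sum_(k < N) rnorm (gam d k) ^+ 2 <= G) ->
        rnorm d ^+ 2 <= m + G + (1 - rho ^+ 2) * (K%:R * rnorm d ^+ 2) + e].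
Proof.
move=> r0 r1; have [D [Ds De _]] := schur_resolventP d.
have [m [hm mub mlb]] := defect_mean W_series W_lin W_contr Ds r0 r1.
have hm' : has_mean (fun t =>
    rnorm (defect (S (circ rho t)) (P (schur_resolvent S (circ rho t) d))) ^+ 2) m.
  rewrite (_ : (fun t => _) = (fun t => rnorm (D (circ rho t)) ^+ 2 -
    rnorm (W (circ rho t) (D (circ rho t))) ^+ 2))//.
  apply/funext => t; have t1 : `|circ rho t| < 1 by rewrite normr_circ// ltcR.
  rewrite De// rnorm_schur_W//; last exact: S_contr.
  by rewrite opprB addrC subrK.
exists m; first exact: circle_mean_has_mean hm'.
by split=> //; apply: has_mean_le (has_mean_cst 0) hm' _ => t; exact: sqr_ge0.
Qed.

End Isometry.

(** * The isometry criterion *)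

Lemma rnorm_h2 (R : realType) (V : normedModType R[i]) (f : h2 V) :
  rnorm f ^+ 2 = limn (sqr_series (h2_coef f)).
Proof.
have f0 : 0 <= limn (sqr_series (h2_coef f)).
  exact: le_trans (sqr_series_ge0 _ 0) (sqr_series_le 0 (@h2_summable _ _ f)).
rewrite {1}/rnorm; exact: sqr_sqrtr.
Qed.

Lemma sqr_seriesE (R : realType) (V : normedModType R[i]) (a : nat -> V) n :
  sqr_series a n = \sum_(k < n) rnorm (a k) ^+ 2.
Proof. by rewrite /sqr_series seriesEord. Qed.

Theorem proposition4p1 (R : realType) (H H' : hilbertType R)
  (sepH : separable_space H) (sepH' : separable_space H')
  (T' : boundedOp H' H') (T : boundedOp H H) (X : boundedOp H H')
  (T'_contraction : contractive T') (T'_cnu : completely_nonunitary T')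
  (T_isometry : isometric T)
  (X_intertwines : forall h, T' (X h) = X (T h)) (X_contraction : contractive X)
  (S : R[i] -> boundedOp (op_kernel (omega_bar T' T X))
                         (op_kernel (adjoint (omega_bar T' T X))))
  (S_schur : schur_class S)
  (Y : boundedOp H (lifting_space T'))
  (Y_lifting : contractive_intertwining_lifting T' T X Y)
  (Y_associated : associated_lifting S Y) :
  isometric Y <->
  forall d : defect_space X,
    circle_mean (fun z => rnorm (defect (S z)
        (proj_kernel (omega_bar T' T X) (schur_resolvent S z d))) ^+ 2) rho
      @[rho --> 1^'-] --> 0%E
    /\
    exists2 d_ : nat -> defect_space X,
      power_series_on_disc (schur_resolvent S ^~ d) d_ &
      rnorm (d_ n) @[n --> \oo] --> (0 : R).
Proof.
have [[Sn S_series] S_contr] := S_schur.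
have [_ _ Y_contr] := Y_lifting.
pose Wn := schur_W_coef Sn.
pose gam d n := (W_coef Wn d n).1.
have W_series := schur_W_series S_series.
have W_lin := schur_W_lin T'_contraction T_isometry X_intertwines X_contraction S.
have Wn_lin := schur_W_coef_lin T'_contraction T_isometry X_intertwines X_contraction Sn.
have W_contr z d (z1 : `|z| < 1) : rnorm (schur_W S z d) <= rnorm d.
  exact: (schur_W_contr T'_contraction T_isometry X_intertwines X_contraction d (S_contr z z1)).
have en d N : \sum_(k < N) rnorm (gam d k) ^+ 2 + rnorm (resolvent_coef Wn d N) ^+ 2 <=
    rnorm d ^+ 2 by exact: (energy W_series W_lin W_contr d N).
have gam_le d N : sqr_series (gam d) N <= rnorm d ^+ 2.
  by rewrite sqr_seriesE; apply: le_trans (en d N); rewrite lerDl sqr_ge0.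
have gam_cv d : square_summable (gam d) := square_summable_bounded (gam_le d).
have Ycoef h : h2_coef (Y h).2 = gam (to_defect X h).
  have [_ Yh] := Y_associated h; apply: power_series_uniq Yh _.
  exact: (schur_Gamma_series T'_contraction T_isometry X_intertwines X_contraction
    S_series S_contr).
(* Since |X h|^2 = |h|^2 - |D_X h|^2, [Y] preserves |h| exactly when sum |gamma_n|^2 = |D_X h|^2. *)
have Ynorm h : rnorm (Y h) ^+ 2 =
    rnorm h ^+ 2 - rnorm (to_defect X h) ^+ 2 + limn (sqr_series (gam (to_defect X h))).
  rewrite rnorm_dsum rnorm_h2 Ycoef (Y_associated h).1 rnorm_to_defect//; lra.
split=> [Y_iso d|cond h].
- have l_le x : limn (sqr_series (gam x)) <= rnorm x ^+ 2.
    by apply: limr_le; [exact: gam_cv|exact: nearW].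
  have l_defect k : limn (sqr_series (gam (to_defect X k))) = rnorm (to_defect X k) ^+ 2.
    by have := Ynorm k; rewrite {1}/rnorm Y_iso -/(rnorm k); lra.
  have gamD x y : gam x = gam y \+ gam (x - y).
    apply/funext => n; rewrite /= /gam -{1}(subrKC y x) -{1}(scale1r y).
    by rewrite (W_coef_lin Wn_lin) scale1r.
  (* Density of the range of [D_X], and [d |-> Gamma d] being contractive. *)
  have gam_tot : limn (sqr_series (gam d)) = rnorm d ^+ 2.
    apply/eqP; rewrite eq_le l_le/=.
    set l := limn _; have l0 : 0 <= l.
      exact: le_trans (sqr_series_ge0 (gam d) 0) (sqr_series_le 0 (gam_cv d)).
    suff : rnorm d <= Num.sqrt l.
      move=> h; rewrite -[leRHS](sqr_sqrtr l0) lerXn2r ?nnegrE ?rnorm_ge0 ?sqrtr_ge0//.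
    apply/ler_addgt0Pr => e e0.
    have /asboolP/closure_normP/(_ (e / 2)%:C) := valP d.
    rewrite gtr0C divr_gt0// => /(_ isT)[_ [k _ <-]].
    rewrite norm_rnorm ltcR => dk; set x := to_defect X k.
    have {}dk : rnorm (x - d) < e / 2 by rewrite rnormC.
    (* Minkowski's inequality for gam x = gam d + gam (x - d), the last part being bounded by |x -
       d|. *)
    have xl : rnorm x <= Num.sqrt l + rnorm (x - d).
      rewrite -(ler_pXn2r (n := 2)) ?nnegrE ?addr_ge0 ?rnorm_ge0 ?sqrtr_ge0//.
      rewrite -l_defect; apply: limr_le; first exact: gam_cv.
      apply: nearW => n; rewrite (gamD x d).
      apply: le_trans (sqr_seriesD_le n (gam_cv d) (gam_cv (x - d))) _.
      rewrite lerXn2r ?nnegrE ?addr_ge0 ?rnorm_ge0 ?sqrtr_ge0// lerD2l.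
      by rewrite -[leRHS](ger0_norm (rnorm_ge0 _)) -sqrtr_sqr ler_wsqrtr// l_le.
    have := ler_rnormB x (x - d); rewrite opprB addrC subrK; lra.
  have gam_cvg : sqr_series (gam d) @ \oo --> rnorm d ^+ 2.
    by rewrite -gam_tot; exact: gam_cv.
  split.
    (* [circle_mean] is an extended real, so its finiteness near 1 is settled first. *)
    apply/fine_cvgP; split.
      near=> rho.
      have r0 : 0 <= rho by near: rho; exact: nbhs_left_ge.
      have r1 : rho < 1 by near: rho; exact: nbhs_left_lt.
      have [m mE _] := circle_meanP T'_contraction T_isometry X_intertwines X_contraction
        S_series S_contr d r0 r1.
      by rewrite mE.
    apply/cvgrPdist_le => e e0.
    have e20 : 0 < e / 2 by rewrite divr_gt0.
    (* N is fixed first, so that the first N terms of sum |gamma_k|^2 come within e / 2 of |d|^2;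
       then rho is moved close to 1 for this finite sum. *)
    have /cvgrPdist_le/(_ _ e20)[N _ /(_ N (leqnn N)) HN] := gam_cvg.
    have /cvgrPdist_le/(_ _ e20) near_sq := sqsum_cvg1 (a := gam d) (n := N).
    near=> rho.
    have r0 : 0 <= rho by near: rho; exact: nbhs_left_ge.
    have r1 : rho < 1 by near: rho; exact: nbhs_left_lt.
    have [m /= -> [m0 mN _]] := circle_meanP T'_contraction T_isometry X_intertwines
      X_contraction S_series S_contr d r0 r1.
    rewrite sub0r normrN /= ger0_norm//; apply: le_trans (mN N) _.
    have : `|\sum_(k < N) rnorm (gam d k) ^+ 2 - sqsum rho (gam d) N| <= e / 2 by near: rho.
    move: HN; rewrite /= sqr_seriesE !ler_norml; lra.
  have [D [_ _ Ds]] := schur_resolventP T'_contraction T_isometry X_intertwines X_contraction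
    S_series S_contr d.
  exists (resolvent_coef Wn d) => //.
  (* [energy] gives |d_n|^2 <= |d|^2 - sum_(k < n) |gamma_k|^2, which tends to 0. *)
  apply: (@cvg_dist_le _ _ (fun n => Num.sqrt (rnorm d ^+ 2 - sqr_series (gam d) n))).
    move=> n; rewrite subr0 -sqrtr_sqr ler_wsqrtr// sqr_seriesE.
    by have := en d n; lra.
  rewrite -[X in _ --> X]sqrtr0; apply: continuous_cvg; first exact: sqrt_continuous.
  by rewrite -(subrr (rnorm d ^+ 2)); apply: cvgB => //; exact: cvg_cst.
set d := to_defect X h; have [cm [d_ ds d0]] := cond d.
have [D [_ _ Ds]] := schur_resolventP T'_contraction T_isometry X_intertwines X_contraction
  S_series S_contr d.
(* Taylor coefficients are unique, so the hypothesis on [d_] concerns the recursive coefficients. *)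
rewrite (power_series_uniq ds Ds) {ds Ds D} in d0.
set G := limn (sqr_series (gam d)).
(* Contractivity of [Y] supplies the reverse inequality. *)
suff dG : rnorm d ^+ 2 <= G.
  apply/eqP; rewrite eq_le Y_contr le_rnorm/=.
  rewrite -(ler_pXn2r (n := 2)) ?nnegrE ?rnorm_ge0// Ynorm -/d -/G; lra.
apply/ler_addgt0Pr => e e0.
(* Three errors share e: the circle mean, the first K terms of the Abel mean, and its tail. *)
have e30 : 0 < e / 3 by rewrite divr_gt0.
have [K _ dK] : \forall k \near \oo, rnorm (resolvent_coef Wn d k) ^+ 2 <= e / 3.
  have /cvgrPdist_le/(_ _ e30) : rnorm (resolvent_coef Wn d n) ^+ 2 @[n --> \oo] --> (0 : R).
    have h2 := cvgM d0 d0; rewrite mulr0 in h2.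
    rewrite (_ : (fun n => _) = (fun n => rnorm (resolvent_coef Wn d n) *
      rnorm (resolvent_coef Wn d n))); first exact: h2.
    by apply/funext => n; rewrite expr2.
  by apply: filterS => k; rewrite sub0r normrN ger0_norm ?sqr_ge0.
have /fine_cvgP[_ /cvgrPdist_le/(_ _ e30) cm0] := cm.
pose c := K%:R * rnorm d ^+ 2.
have rc : (1 - rho ^+ 2) * c @[rho --> (1 : R)^'-] --> (0 : R).
  have r2 : rho ^+ 2 @[rho --> (1 : R)^'-] --> (1 : R).
    rewrite -[X in _ --> X](expr1n R 2).
    by apply: cvg_at_left_filter; exact: (@exprn_continuous R 2 1).
  have r3 : 1 - rho ^+ 2 @[rho --> (1 : R)^'-] --> (0 : R).
    by rewrite -[X in _ --> X](subrr (1 : R)); apply: cvgB => //; exact: cvg_cst.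
  by rewrite -[X in _ --> X](mul0r c); apply: cvgM => //; exact: cvg_cst.
move/cvgrPdist_le : rc => /(_ _ e30) rc0.
near (1 : R)^'- => rho.
have r0 : 0 <= rho by near: rho; exact: nbhs_left_ge.
have r1 : rho < 1 by near: rho; exact: nbhs_left_lt.
have [m mE [m0 _ mG]] := circle_meanP T'_contraction T_isometry X_intertwines
  X_contraction S_series S_contr d r0 r1.
have me : m <= e / 3.
  have : `|0 - fine (m%:E)| <= e / 3 by rewrite -mE; near: rho.
  by rewrite sub0r normrN /= ger0_norm.
have ce : (1 - rho ^+ 2) * c <= e / 3.
  have : `|0 - (1 - rho ^+ 2) * c| <= e / 3 by near: rho.
  by rewrite sub0r normrN; exact/le_trans/ler_norm.
have := mG K (e / 3) G (ltW e30).
have gG N : \sum_(k < N) rnorm (gam d k) ^+ 2 <= G.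
  by rewrite -sqr_seriesE; exact: sqr_series_le.
move=> /(_ (fun k Kk => dK k.+1 (leqW Kk)) gG).
rewrite -/c; lra.
Unshelve. all: by end_near. Qed.
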